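(* Let $Q=\{q_1,\ldots,q_k\}$ be a finite set of (distinct) prime numbers with $k\geq 2$. Then for each integer $d>1$ there exists an infinite word $w=w(Q,d)$ on a $d$-letter alphabet such that its arithmetical complexity $a_w(n)$ satisfies $$\frac{a_w(n)}{n^{\alpha(Q,d)+1}}\to C\quad\text{as } n\to\infty,$$ where $C$ is a positive constant and $\alpha(Q,d)$ is the unique positive real root $x$ of the equation $$\frac{d-1}{d}=\prod_{i=1}^{k}\bigl(1-q_i^{-x}\bigr).$$
   Context: An infinite word over a finite alphabet $\Sigma$ is a sequence $w=w_1w_2w_3\cdots$ with $w_i\in\Sigma$. An arithmetical factor of $w$ is a finite word of the form $w_kw_{k+r}w_{k+2r}\cdots w_{k+mr}$ with $r>0$. The arithmetical complexity $a_w(n)$ is the number of distinct arithmetical factors of $w$ of length $n$. The equation defining $\alpha(Q,d)$ has exactly one positive root, because the product is increasing in $x\ge 0$, equals $0$ at $x=0$, and tends to $1$ as $x\to\infty$. *)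

(* Defs.v *)
From mathcomp Require Import all_boot all_order all_algebra.
From mathcomp Require Import finmap.
From mathcomp Require Import all_classical all_reals all_analysis.
Set Implicit Arguments.
Unset Strict Implicit.
Unset Printing Implicit Defensive.
Import Order.TTheory GRing.Theory Num.Theory.
Local Open Scope ring_scope.

(* Letters are indexed from 0: [w i] is the letter w_{i+1}. *)
Definition infinite_word (A : finType) := nat -> A.

Definition arith_factor (A : finType) (w : infinite_word A) (u : seq A) : Prop :=
  exists k r m : nat,
    (0 < r)%N /\ u = mkseq (fun i => w (k + i * r)%N) m.+1.

(* Arithmetical factors are nonempty, so the value at n = 0 is 0. *)
Definition arith_complexity (A : finType) (w : infinite_word A) (n : nat) : nat :=
  #|[pred u : n.-tuple A | `[< arith_factor w u >]]|.

Definition positive_root (R : realType) (Q : {fset nat}) (d : nat) (x : R) : Prop :=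
  0 < x /\ (d%:R - 1) / d%:R = \prod_(q <- Q) (1 - q%:R `^ (- x)).

(* Main.v *)
Require Import Defs.
From mathcomp Require Import all_boot all_order all_algebra.
From mathcomp Require Import finmap.
From mathcomp Require Import all_classical all_reals all_analysis.
From mathcomp Require Import zify ring lra.
Set Implicit Arguments.
Unset Strict Implicit.
Unset Printing Implicit Defensive.
Import Order.TTheory GRing.Theory Num.Theory.
Import numFieldNormedType.Exports.

(* Let [w] be the Toeplitz word directed by a stream of pairs (q, a) in Q x A:
   the positions not divisible by the first prime q carry the first letter a,
   and the multiples of q carry the word directed by the rest of the stream.
   If the stream contains every finite pattern, the arithmetical factors of [w]
   are exactly the "layered" words: those equal to a letter b outside a residue
   class modulo some q in Q and layered again inside that class.

   Order the primes arbitrarily as q_0, ..., q_(k-1) and let A_j(n) count the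
   pairs (u, b), u a layered word of length n other than b^n that has background
   b modulo none of q_i, i < j.  For all but boundedly many u the background
   letter is unique, hence, up to a bounded error,
     A_j(n) = sum_i (d - [i < j]) sum_(s < q_i) A_i(ceil((n - s) / q_i)),
   a recurrence with positive weights.  With h_i = prod_(l < i) (1 - q_l^-alpha),
   the equation defining alpha says that n^(alpha+1) h_j solves it
   asymptotically, so F_j(n) = A_j(n) / (h_j n^(alpha+1)) is, up to O(1/n), a
   convex combination of the F_i(n / q_i).

   Since two distinct primes are multiplicatively independent, a value of F
   close to its limsup M forces F to be close to M on a whole interval
   [x, (max q) x]; the recurrence then keeps F close to M from x on.  So F tends
   to M, and a subsolution c (n+1)^(alpha+1) of the recurrence gives M > 0. *)

(* For s < q this is ceil((n - s) / q), the number of y with s + q * y < n. *)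
Definition class_size (n q s : nat) : nat := (n + (q.-1 - s)) %/ q.

Lemma lt_class_size n q s x : s < q -> (x < class_size n q s) = (s + q * x < n).
Proof.
move=> hs; have q0 : 0 < q by apply: leq_trans hs.
by rewrite /class_size leq_divRL // mulSn; lia.
Qed.

Lemma class_size_lt n q s : 1 < q -> 1 < n -> class_size n q s < n.
Proof.
move=> hq hn; rewrite /class_size ltn_divLR; last lia.
have : n.-1 * q >= n.-1 * 2 by rewrite leq_mul2l hq orbT.
have: n * q = q + n.-1 * q by rewrite -mulSn prednK //; lia.
nia.
Qed.

Lemma class_sizeSS n q s : s.+1 < q -> class_size n.+1 q s.+1 = class_size n q s.
Proof. by move=> hs; rewrite /class_size; congr (_ %/ _); lia. Qed.

Lemma class_size_last n q : 0 < q -> class_size n q q.-1 = n %/ q.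
Proof. by move=> hq; rewrite /class_size subnn addn0. Qed.

Lemma class_size0 n q : 0 < q -> class_size n.+1 q 0 = (n %/ q).+1.
Proof.
move=> hq; rewrite /class_size subn0 addSn -addnS prednK //.
by rewrite divnDr // divnn hq addn1.
Qed.

Lemma class_size_bounds n q s : s < q -> n %/ q <= class_size n q s <= (n %/ q).+1.
Proof.
move=> hs; have q0 : 0 < q by apply: leq_trans hs.
rewrite -[(n %/ q).+1]class_size0 // /class_size.
by apply/andP; split; apply: leq_div2r; lia.
Qed.

Lemma modn_affine_inj d k r x y : coprime d r ->
  k + x * r = k + y * r %[mod d] -> x = y %[mod d].
Proof.
move=> cop; wlog xy : x y / y <= x => [H e|].
  by case/orP: (leq_total x y) => [/H ->|/H ->].
move/eqP; rewrite eqn_mod_dvd ?leq_add2l ?leq_mul2r ?xy ?orbT //.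
rewrite subnDl -mulnBl Gauss_dvdl // => h.
by apply/eqP; rewrite eqn_mod_dvd.
Qed.

(** * Toeplitz words and layered words *)

Section LayeredWords.
Variables (I A : finType) (q : I -> nat).
Hypothesis q_prime : forall i, prime (q i).

Let q_gt1 i : 1 < q i := prime_gt1 (q_prime i).
Let q_gt0 i : 0 < q i := prime_gt0 (q_prime i).

(* A word of length n is a function on nat of which only the values on [0, n)
   matter. *)
Inductive layered : nat -> (nat -> A) -> Prop :=
| layered_short n f : n <= 1 -> layered n f
| layered_step n f i s b :
    s < q i -> (forall x, x < n -> x %% q i != s -> f x = b) ->
    layered (class_size n (q i) s) (fun x => f (s + q i * x)) -> layered n f.

Lemma eq_layered n f g : (forall x, x < n -> f x = g x) -> layered n f -> layered n g.
Proof.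
move=> + hf; elim: hf g => {n f} [n f hn g _|n f i s b hs hb _ IH g fg].
  exact: layered_short.
apply: (@layered_step n g i s b) => // [x xn xs|]; first by rewrite -fg ?hb.
by apply: IH => x; rewrite lt_class_size // => /fg.
Qed.

Section Toeplitz.
Variable a0 : A.

(* Position 0 lies in every hole; it gets the letter a0, and so does any
   position at which the fuel m runs out. *)
Fixpoint toeplitz_rec (m : nat) (sigma : nat -> I * A) (x : nat) : A :=
  if m is m'.+1 then
    if q (sigma 0).1 %| x
    then toeplitz_rec m' (fun j => sigma j.+1) (x %/ q (sigma 0).1)
    else (sigma 0).2
  else a0.

Definition toeplitz (sigma : nat -> I * A) (x : nat) : A := toeplitz_rec x sigma x.

Lemma toeplitz_rec_fuel m sigma x : x <= m -> toeplitz_rec m sigma x = toeplitz sigma x.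
Proof.
elim/ltn_ind: m sigma x => -[|m] IH sigma [|x] //= hx.
  rewrite dvdn0 div0n; rewrite IH //.
rewrite /toeplitz /=; case: ifP => // qx.
have h : x.+1 %/ q (sigma 0).1 <= x by rewrite -ltnS ltn_Pdiv.
by rewrite !IH //; apply: leq_trans h _.
Qed.

Lemma toeplitzE sigma x :
  toeplitz sigma x = if q (sigma 0).1 %| x
    then toeplitz (fun j => sigma j.+1) (x %/ q (sigma 0).1) else (sigma 0).2.
Proof.
rewrite -(@toeplitz_rec_fuel x.+1) //=; case: ifP => // _.
by rewrite toeplitz_rec_fuel // leq_div.
Qed.

(** Such a position lies in the first j nested holes. Patterns late in the stream thus become
    visible along a progression. *)
Lemma toeplitz_scale sigma j x :
  toeplitz sigma (\prod_(i < j) q (sigma i).1 * x) = toeplitz (fun m => sigma (j + m)) x.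
Proof.
elim: j sigma => [|j IH] sigma; first by rewrite big_ord0 mul1n.
by rewrite big_ord_recl /= -mulnA toeplitzE dvdn_mulr // mulKn.
Qed.
End Toeplitz.

Lemma layered_const n (b : A) (i0 : I) : layered n (fun=> b).
Proof.
elim/ltn_ind: n => n IH.
have [n1|n1] := leqP n 1; first exact: layered_short.
by apply: (@layered_step n _ i0 0 b) => //; apply/IH/class_size_lt.
Qed.

(** Taking the class of the exceptional position as the hole leaves a shorter word of the same
    kind. *)
Lemma layered_single n (b : A) (i0 : I) (y : nat) f :
  (forall x, x != y -> f x = b) -> layered n f.
Proof.
elim/ltn_ind: n y f => n IH y f hf.
have [n1|n1] := leqP n 1; first exact: layered_short.
apply: (@layered_step n _ i0 (y %% q i0) b); first by rewrite ltn_mod.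
  by move=> x _ xy; apply: hf; apply: contraNneq xy => ->.
apply: (IH _ _ (y %/ q i0)); first exact: class_size_lt.
move=> x xy; apply: hf; apply: contraNneq xy => e.
by rewrite -e mulnC addnC divnMDl // divn_small ?addn0 // ltn_mod.
Qed.

Lemma coprime_solve (p r k : nat) : prime p -> ~~ (p %| r) ->
  exists2 s, s < p & p %| k + s * r.
Proof.
move=> pp pr; have p0 := prime_gt0 pp.
have cop : coprime r p by rewrite coprime_sym prime_coprime.
have r0 : 0 < r by case: r pr cop => //; rewrite dvdn0.
case: (egcdnP p r0) => u v e _; rewrite (eqP cop) in e.
(* Here [u] inverts [r] modulo [p] and [p.-1] stands for -1, so the witness is -k/r modulo [p]. *)
exists ((u * ((p.-1) * k)) %% p); first by rewrite ltn_mod.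
rewrite /dvdn -modnDmr -modnMml modn_mod modnMml modnDmr.
have -> : k + u * (p.-1 * k) * r = k * p + v * p * (p.-1 * k).
  have -> : u * (p.-1 * k) * r = (u * r) * (p.-1 * k) by lia.
  rewrite e mulnDl mul1n.
  have : p = p.-1.+1 by rewrite prednK.
  nia.
by rewrite -mulnA [p * (_ * _)]mulnC mulnA -mulnDl modnMl.
Qed.

(** If [q i0] does not divide [r], the progression meets the hole in a single class and the length
    drops. Otherwise it lies outside the hole, where it is constant, or inside, where the length
    stays but [k + r] drops; hence the inner induction. *)
Lemma toeplitz_layered a0 sigma n k r :
  layered n (fun i => toeplitz a0 sigma (k + i * r)).
Proof.
elim/ltn_ind: n sigma k r => n IHn sigma k r.
have [m] := ubnP (k + r); elim: m sigma k r => // m IHm sigma k r hm.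
have [n1|n1] := leqP n 1; first exact: layered_short.
set i0 := (sigma 0).1; set a := (sigma 0).2.
have [qr|qr] := boolP (q i0 %| r).
  have [qk|qk] := boolP (q i0 %| k).
    (* For k = r = 0 division by the prime decreases nothing, but the word is constant. *)
    have [/eqP|kr0] := posnP (k + r).
      rewrite addn_eq0 => /andP[/eqP-> /eqP->].
      apply: (@eq_layered _ (fun=> a0)) (layered_const n a0 i0).
      by move=> x _; rewrite muln0.
    apply: (@eq_layered _ (fun i => toeplitz a0 (fun j => sigma j.+1)
        (k %/ q i0 + i * (r %/ q i0)))).
      move=> x _; rewrite [RHS]toeplitzE -/i0 dvdn_add ?dvdn_mull //.
      by rewrite divnDl // muln_divA.
    apply: IHm.
    have : k %/ q i0 + r %/ q i0 < k + r by rewrite -divnDl // ltn_Pdiv.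
    by move=> h; apply: leq_trans h _.
  apply: (@eq_layered _ (fun=> a)) (layered_const n a i0).
  by move=> x _; rewrite toeplitzE -/i0 dvdn_addl ?dvdn_mull // (negbTE qk).
have [s sq ds] := coprime_solve k (q_prime i0) qr.
apply: (@layered_step n _ i0 s a sq).
  move=> x _ xs; rewrite toeplitzE -/i0 ifF //; apply/negP => dx.
  have xs' : x != s %[mod q i0] by rewrite (modn_small sq).
  case/negP: xs'; apply/eqP/(@modn_affine_inj _ k r); first by rewrite prime_coprime.
  by rewrite (eqP dx) (eqP ds).
apply: (@eq_layered _ (fun i => toeplitz a0 (fun j => sigma j.+1)
        ((k + s * r) %/ q i0 + i * r))); last by apply/IHn/class_size_lt.
move=> x _; rewrite [RHS]toeplitzE -/i0.
have -> : k + (s + q i0 * x) * r = (x * r) * q i0 + (k + s * r) by lia.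
by rewrite dvdn_addr ?dvdn_mull // ds divnMDl // addnC.
Qed.

(** The prefix [tau] records the primes and background letters of a derivation of [layered].
    Positivity of [k] makes the subtraction of [s] in the inductive step exact. *)
Lemma layered_toeplitz n f a0 (t0 : I * A) : layered n f ->
  exists tau : seq (I * A), forall sigma,
    (forall j, j < size tau -> sigma j = nth t0 tau j) ->
    exists2 k, 0 < k & forall x, x < n -> f x = toeplitz a0 sigma (k + x).
Proof.
elim=> {n f} [n f n1|n f i s b sq hb _ [tau IH]].
  exists [:: (t0.1, f 0)] => sigma /(_ 0 isT) s0; exists 1 => // x xn.
  have -> : x = 0 by lia.
  by rewrite toeplitzE s0 /= dvdn1 ifF //; apply/eqP => q1; have := q_gt1 t0.1; rewrite q1.
exists ((i, b) :: tau) => sigma hs.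
have [k k0 hk] := IH (fun j => sigma j.+1) (fun j hj => hs j.+1 hj).
have s0 := hs 0 isT; rewrite /= in s0.
have sk : s < q i * k by apply: leq_trans sq _; rewrite leq_pmulr.
(* From this start, the positions s + q_i y of the word fall on the multiples q_i (k + y). *)
exists (q i * k - s); first by rewrite subn_gt0.
move=> x xn; rewrite toeplitzE s0 /=.
have [xs|xs] := eqVneq (x %% q i) s.
  have e : q i * k - s + x = q i * (k + x %/ q i).
    by rewrite {1}(divn_eq x (q i)) xs; lia.
  rewrite e dvdn_mulr // mulKn // -hk.
    by congr f; rewrite {1}(divn_eq x (q i)) xs; lia.
  by rewrite lt_class_size // -xs; rewrite {1}(divn_eq x (q i)) in xn; lia.
rewrite ifF ?hb //; apply/negP => dx; case/negP: xs.
rewrite -[X in _ == X](modn_small sq).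
apply/eqP/(@modn_affine_inj _ (q i * k - s) 1); rewrite ?coprimen1 // !muln1.
by rewrite (eqP dx) subnK ?modnMr // ltnW.
Qed.

(* The block of positions [2^c, 2^(c+1)) spells the list coded by logn 2 c; each
   code is taken for arbitrarily large c, hence in a block long enough. *)
Definition universal_stream (T : countType) (t0 : T) (m : nat) : T :=
  let c := trunc_log 2 m in
  nth t0 (odflt [::] (choice.unpickle (logn 2 c))) (m - 2 ^ c).

Lemma universal_streamP (T : countType) (t0 : T) (tau : seq T) :
  exists j, forall x, x < size tau -> universal_stream t0 (j + x) = nth t0 tau x.
Proof.
(* The odd factor keeps the 2-adic valuation equal to the code of [tau] and makes the block longer
   than [tau]. *)
pose c := 2 ^ choice.pickle tau * (size tau).*2.+1.
have cs : size tau < 2 ^ c.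
  apply: (@leq_trans (2 ^ size tau)); first exact: ltn_expl.
  rewrite leq_exp2l // /c; apply: leq_trans (leq_pmull _ _); first lia.
  by rewrite expn_gt0.
exists (2 ^ c) => x xs; rewrite /universal_stream.
have -> : trunc_log 2 (2 ^ c + x) = c.
  by apply: trunc_log_eq => //; rewrite expnS; lia.
have -> : logn 2 c = choice.pickle tau.
  rewrite /c lognM ?expn_gt0 // pfactorK // logn_coprime ?addn0 //.
  by rewrite coprime2n /= odd_double.
by rewrite choice.pickleK /= addnC addnK.
Qed.

End LayeredWords.

(** * Counting layered words *)

Lemma eq_tuple_nth (A : Type) (a0 : A) n (u v : n.-tuple A) :
  (forall x, x < n -> nth a0 u x = nth a0 v x) -> u = v.
Proof.
by move=> h; apply/val_inj/(@eq_from_nth _ a0); rewrite !size_tuple.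
Qed.

Lemma nth_mktuple_nat (A : Type) (a0 : A) n (f : nat -> A) x :
  x < n -> nth a0 [tuple f y | y < n] x = f x.
Proof. by move=> xn; rewrite -[x in LHS]/(nat_of_ord (Ordinal xn)) nth_mktuple. Qed.

Section Counting.
Variables (k : nat) (A : finType) (q : 'I_k -> nat).
Hypothesis q_prime : forall i, prime (q i).
Hypothesis q_inj : injective q.
Variable a0 : A.

Let q_gt1 i : 1 < q i := prime_gt1 (q_prime i).
Let q_gt0 i : 0 < q i := prime_gt0 (q_prime i).

(** Progressions of progressions are progressions, so it suffices to realize [f] inside a Toeplitz
    word. *)
Lemma layered_sub n (f : nat -> A) (i0 : 'I_k) m c r : layered q n f ->
  (forall x, x < m -> c + x * r < n) -> layered q m (fun x => f (c + x * r)).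
Proof.
move=> hf hm; have [tau H] := layered_toeplitz q_prime a0 (i0, a0) hf.
have [j _ e] := H (nth (i0, a0) tau) (fun _ _ => erefl).
apply: (@eq_layered _ _ q _ (fun x => toeplitz q a0 (nth (i0, a0) tau) (j + c + x * r))).
  by move=> x /hm /e ->; rewrite addnA.
exact: toeplitz_layered.
Qed.

Definition background (i : 'I_k) (s : nat) (b : A) n (u : n.-tuple A) : bool :=
  [forall x : 'I_n, (x %% q i != s) ==> (nth a0 u x == b)].

Definition has_background i b n (u : n.-tuple A) : bool :=
  [exists s : 'I_(q i), background i s b u].

Definition const_word n (b : A) : n.-tuple A := [tuple b | _ < n].

Definition layered_words n : {set n.-tuple A} :=
  [set u : n.-tuple A | `[< layered q n (nth a0 u) >]].

(** For fixed [b], the words counted by A_j. Leaving out the constant word makes the residue class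
    of a background unique. *)
Definition fresh (j : nat) (b : A) n : {set n.-tuple A} :=
  [set u : n.-tuple A in layered_words n | (u != const_word n b) &&
     [forall i : 'I_k, (i < j) ==> ~~ has_background i b u]].

Lemma backgroundP i s b n (u : n.-tuple A) :
  reflect (forall x, x < n -> nth a0 u x != b -> x %% q i = s) (background i s b u).
Proof.
apply: (iffP forallP) => [h x xn|h x].
  by apply: contraNeq => /(implyP (h (Ordinal xn))).
by apply/implyP; apply: contraNT => /h ->.
Qed.

Lemma const_wordP b n (u : n.-tuple A) :
  reflect (forall x, x < n -> nth a0 u x = b) (u == const_word n b).
Proof.
apply: (iffP eqP) => [-> x xn|h]; first exact: (nth_mktuple_nat _ (fun=> b)).
apply: (@eq_tuple_nth _ a0) => x xn; rewrite h //.
by rewrite (nth_mktuple_nat _ (fun=> b)).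
Qed.

Lemma background_inj i s t b n (u : n.-tuple A) : u != const_word n b ->
  background i s b u -> background i t b u -> s = t.
Proof.
move=> uc /backgroundP hs /backgroundP ht.
have [/existsP[x ux]|] := boolP [exists x : 'I_n, nth a0 u x != b].
  by rewrite -(hs x) // (ht x).
rewrite negb_exists => /forallP h; case/negP: uc; apply/const_wordP => x xn.
by have := h (Ordinal xn); rewrite negbK => /eqP.
Qed.

(** * Words obtained by filling one residue class *)

Section Extension.
Variables (n : nat) (i : 'I_k) (s : nat) (b : A).
Hypothesis s_lt : s < q i.
Let m := class_size n (q i) s.

Definition spread (v : m.-tuple A) : n.-tuple A :=
  [tuple if y %% q i == s then nth a0 v (y %/ q i) else b | y < n].

Definition restrict (u : n.-tuple A) : m.-tuple A := [tuple nth a0 u (s + q i * y) | y < m].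

Lemma mod_class x : (s + q i * x) %% q i = s.
Proof. by rewrite addnC mulnC modnMDl modn_small. Qed.

Lemma div_class x : (s + q i * x) %/ q i = x.
Proof. by rewrite addnC mulnC divnMDl // divn_small ?addn0. Qed.

Lemma classE x : x %% q i = s -> s + q i * (x %/ q i) = x.
Proof. by move=> xs; rewrite [RHS](divn_eq x (q i)) xs; lia. Qed.

Lemma nth_spread v x : x < m -> nth a0 (spread v) (s + q i * x) = nth a0 v x.
Proof.
rewrite lt_class_size // => xm.
rewrite (nth_mktuple_nat _ (fun y => if y %% q i == s then nth a0 v (y %/ q i) else b)) //.
by rewrite mod_class eqxx div_class.
Qed.

Lemma nth_spread_out v x : x < n -> x %% q i != s -> nth a0 (spread v) x = b.
Proof.
move=> xn xs.
rewrite (nth_mktuple_nat _ (fun y => if y %% q i == s then nth a0 v (y %/ q i) else b)) //.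
by rewrite (negbTE xs).
Qed.

Lemma spreadK : cancel spread restrict.
Proof.
move=> v; apply: (@eq_tuple_nth _ a0) => x xm.
by rewrite (nth_mktuple_nat _ (fun y => nth a0 (spread v) (s + q i * y))) // nth_spread.
Qed.

Lemma nth_spread_neq v x : x < n -> nth a0 (spread v) x != b ->
  [/\ x %% q i = s, x %/ q i < m & nth a0 v (x %/ q i) = nth a0 (spread v) x].
Proof.
move=> xn ub; have xs : x %% q i = s.
  by apply: contraNeq ub => xs; apply/eqP; exact: nth_spread_out.
have xm : x %/ q i < m by rewrite lt_class_size // classE.
by split=> //; rewrite -[in RHS](classE xs) nth_spread.
Qed.

Lemma background_spread v : background i s b (spread v).
Proof. by apply/backgroundP => x xn /(nth_spread_neq xn)[]. Qed.

Lemma restrictK u : background i s b u -> spread (restrict u) = u.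
Proof.
move=> /backgroundP h; apply: (@eq_tuple_nth _ a0) => x xn.
have [xs|xs] := eqVneq (x %% q i) s.
  have xm : x %/ q i < m by rewrite lt_class_size // classE.
  rewrite -{1}(classE xs) nth_spread //.
  by rewrite (nth_mktuple_nat _ (fun y => nth a0 u (s + q i * y))) // classE.
rewrite nth_spread_out //; apply/esym/eqP; apply: contraNT xs => /(h _ xn) ->.
by rewrite eqxx.
Qed.

(** One direction is the constructor of [layered]; the other reads the class as a progression and
    uses [layered_sub]. *)
Lemma layered_spread v : (spread v \in layered_words n) = (v \in layered_words m).
Proof.
rewrite !inE; apply/asboolP/asboolP => h; last first.
  apply: (@layered_step _ _ q n _ i s b s_lt); first by move=> x; apply: nth_spread_out.
  by apply: eq_layered h => // x xm; rewrite nth_spread.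
apply: (@eq_layered _ _ q _ (fun x => nth a0 (spread v) (s + x * q i))).
  by move=> x xm; rewrite mulnC nth_spread.
by apply: layered_sub h _ => // x; rewrite lt_class_size // mulnC.
Qed.

Lemma const_spread v : (spread v == const_word n b) = (v == const_word m b).
Proof.
apply/const_wordP/const_wordP => h x xn.
  by rewrite -nth_spread // h // -lt_class_size.
apply/eqP; apply: contraT => ub; have [xs xm e] := nth_spread_neq xn ub.
by rewrite -e h ?eqxx in ub.
Qed.

(** As [q i] is invertible modulo [q l], the map sending y to s + q_i y permutes the classes modulo
    [q l], and background classes correspond under it. *)
Lemma has_background_spread l v : l != i ->
  has_background l b (spread v) = has_background l b v.
Proof.
move=> li.
have cop : coprime (q l) (q i).
  by rewrite prime_coprime // dvdn_prime2 //; apply: contra li => /eqP/q_inj->.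
apply/existsP/existsP => -[t /backgroundP ht]; last first.
  have ts : (s + q i * t) %% q l < q l by rewrite ltn_mod.
  exists (Ordinal ts); apply/backgroundP => x xn ub /=.
  have [xs xm e] := nth_spread_neq xn ub.
  rewrite -[x in LHS](classE xs) -modnDmr -modnMmr (ht _ xm) ?e //.
  by rewrite modnDmr.
(* The position of a letter other than [b] determines the class; if there is none, any class will
   do. *)
have [/existsP[y vy]|] := boolP [exists y : 'I_m, nth a0 v y != b]; last first.
  rewrite negb_exists => /forallP h; exists (Ordinal (q_gt0 l)).
  apply/backgroundP => x xm; have := h (Ordinal xm) => /= h'.
  by rewrite (negbTE h').
have ys : y %% q l < q l by rewrite ltn_mod.
exists (Ordinal ys); apply/backgroundP => x xm vx /=.
apply: (modn_affine_inj (k := s) (r := q i)) => //.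
by rewrite -![_ * q i]mulnC !ht -?lt_class_size // nth_spread.
Qed.

(** Freshness tests only primes of index below [j <= i], all different from [q i]. *)
Lemma fresh_spread j v : j <= i -> (spread v \in fresh j b n) = (v \in fresh j b m).
Proof.
move=> ji; rewrite /fresh finset.in_set [RHS]finset.in_set.
rewrite -layered_spread const_spread; congr (_ && (_ && _)).
apply: eq_forallb => l; have [lj|//] := ltnP l j.
rewrite /= has_background_spread //; apply: contraTneq lj => ->.
by rewrite -leqNgt.
Qed.

Lemma card_fresh_background j : j <= i ->
  #|[set u in fresh j b n | background i s b u]| = #|fresh j b m|.
Proof.
move=> ji; rewrite -(card_imset _ (can_inj spreadK)); apply: eq_card => u.
rewrite inE; apply/andP/imsetP => [[uf ub]|[v vf ->]].
  by exists (restrict u); rewrite -1?(fresh_spread _ ji) restrictK.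
by rewrite fresh_spread // background_spread.
Qed.

End Extension.

(** Double counting of pairs (u, s): by [background_inj] each such word has exactly one class [s],
    and the words with a given class are the spreads of shorter fresh words. *)
Lemma card_fresh_has_background n (i : 'I_k) j b : j <= i ->
  #|[set u in fresh j b n | has_background i b u]|
  = \sum_(s < q i) #|fresh j b (class_size n (q i) s)|.
Proof.
move=> ji; under eq_bigr => s _ do rewrite -card_fresh_background //.
under eq_bigr => s _ do rewrite cardsE -sum1_card big_mkcondr /=.
rewrite exchange_big /= -sum1_card.
rewrite (eq_bigl (fun u => (u \in fresh j b n) && has_background i b u)); last first.
  by move=> u; rewrite inE.
rewrite big_mkcondr /=; apply: eq_bigr => u uf.
have uc : u != const_word n b by move: uf; rewrite inE => /andP[_ /andP[]].
case: ifP => [/existsP[s hs]|/negbT]; last first.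
  rewrite negb_exists => /forallP h; rewrite big1 // => s _.
  by rewrite (negbTE (h s)).
rewrite (bigD1 s) //= hs big1 // => t ts; case: ifP => // ht.
by case/negP: ts; apply/eqP/val_inj; exact: background_inj uc ht hs.
Qed.

Lemma const_word_layered (i0 : 'I_k) b n : const_word n b \in layered_words n.
Proof.
rewrite inE; apply/asboolP; apply: eq_layered (layered_const q_prime n b i0).
by move=> x xn; rewrite (nth_mktuple_nat _ (fun=> b)).
Qed.

Lemma card_fresh0 (i0 : 'I_k) b n : (#|fresh 0 b n| + 1 = #|layered_words n|)%N.
Proof.
rewrite (cardsD1 (const_word n b) (layered_words n)) const_word_layered // addnC; congr (_ + _).
apply: eq_card => u; rewrite finset.in_set finset.in_setD1 andbC -andbA; congr (_ && _).
by apply: andb_idl => _; apply/forallP.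
Qed.

Lemma card_freshS (i : 'I_k) b n :
  #|fresh i.+1 b n| + #|[set u in fresh i b n | has_background i b u]| = #|fresh i b n|.
Proof.
rewrite -(cardsID [set u | has_background i b u] (fresh i b n)) addnC; congr (_ + _).
  by apply: eq_card => u; rewrite !finset.in_set.
apply: eq_card => u; rewrite finset.in_set finset.in_setD !finset.in_set.
rewrite [RHS]andbCA; congr andb; rewrite [RHS]andbCA; congr andb.
apply/forallP/andP => [h|[h1 /forallP h2] l].
  split; first by have /implyP/(_ (leqnn _)) := h i.
  by apply/forallP => l; apply/implyP => li; have /implyP/(_ (ltnW li)) := h l.
apply/implyP; rewrite ltnS leq_eqVlt => /orP[/eqP/val_inj->//|li].
by have /implyP/(_ li) := h2 l.
Qed.

(** * The recurrence for the counts A_j *)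

Definition fresh_count (j n : nat) : nat := \sum_(b : A) #|fresh j b n|.

Definition class_sum (i : 'I_k) (n : nat) : nat :=
  \sum_(s < q i) fresh_count i (class_size n (q i) s).

(** Sorting the words by the first prime modulo which they have background [b] gives a telescoping
    sum; the term [#|A|] counts the constant words b^n. *)
Lemma fresh_countE (i0 : 'I_k) j n : j <= k ->
  fresh_count j n + \sum_(i < k | i < j) class_sum i n + #|A| = #|A| * #|layered_words n|.
Proof.
elim: j => [|j IH] jk.
  rewrite big_pred0 ?addn0 // /fresh_count -[in X in _ + X]sum1_card -big_split /=.
  by under eq_bigr => b _ do rewrite card_fresh0 //; rewrite sum_nat_const.
rewrite -(IH (ltnW jk)); pose i := Ordinal jk.
rewrite (bigD1 i) //= addnA; congr (_ + _ + _); last first.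
  by apply: eq_bigl => l; rewrite ltnS andbC [_ <= j]leq_eqVlt -(inj_eq val_inj) /=; case: ltngtP.
rewrite /fresh_count /class_sum exchange_big -big_split /=; apply: eq_bigr => b _.
by rewrite -(@card_fresh_has_background n i i b) // (card_freshS i).
Qed.

(** The only long words that may have two background letters; equal entries give the constant
    words. *)
Definition alternating (n : nat) (c : A * A) : n.-tuple A :=
  [tuple if odd x then c.1 else c.2 | x < n].

(* Long enough for the Chinese remainder theorem to provide a position avoiding
   two given classes modulo distinct primes. *)
Definition background_bound : nat := (\max_i q i) ^ 2 + 3.

Lemma background_bound_ge i j : q i * q j <= background_bound.
Proof.
rewrite /background_bound -mulnn; apply: leq_trans (leq_addr _ _).
by rewrite leq_mul // leq_bigmax.
Qed.

(* Two background letters can only coexist modulo 2. *)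
Lemma has_background_uniq n (u : n.-tuple A) i j b c :
  background_bound <= n -> has_background i b u -> has_background j c u -> b != c ->
  u \in [set alternating n p | p : A * A].
Proof.
move=> nb /existsP[[s sq] /backgroundP /= hs] /existsP[[t tq] /backgroundP /= ht] bc.
have no x : x < n -> x %% q i != s -> x %% q j != t -> False.
  move=> xn xs xt; have /eqP ub : nth a0 u x == b.
    by apply: contraNT xs => /(hs _ xn)->.
  have /eqP uc : nth a0 u x == c by apply: contraNT xt => /(ht _ xn)->.
  by case/eqP: bc; rewrite -ub -uc.
have n3 : 3 <= n by apply: leq_trans nb; apply: leq_addl.
have [ij|ij] := eqVneq i j; last first.
  have cop : coprime (q i) (q j).
    by rewrite prime_coprime // dvdn_prime2 //; apply: contra ij => /eqP/q_inj->.
  (* The prescribed residues, 0 or 1, are chosen to differ from [s] and from [t]. *)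
  pose x := chinese (q i) (q j) (s == 0) (t == 0).
  have neq (l : 'I_k) r : (r == 0) %% q l != r.
    have := q_gt1 l; case: r => [|r'] q1 /=; first by rewrite modn_small.
    by rewrite mod0n.
  case: (no (x %% (q i * q j))).
  - by apply: leq_trans (leq_trans (background_bound_ge i j) nb); rewrite ltn_mod muln_gt0 !q_gt0.
  - by rewrite modn_dvdm ?dvdn_mulr // chinese_modl // neq.
  - by rewrite modn_dvdm ?dvdn_mull // chinese_modr // neq.
rewrite -ij in ht no tq.
(* Two classes modulo the same prime cannot cover the positions 0, 1 and 2 if these are distinct
   modulo it. *)
have [q3|q3] := leqP 3 (q i).
  have c0 := no 0 ltac:(lia); have c1 := no 1 ltac:(lia); have c2 := no 2 ltac:(lia).
  rewrite !modn_small // in c0 c1 c2.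
  have : (0 == s) || (0 == t) by apply/norP => -[]; exact: c0.
  have : (1 == s) || (1 == t) by apply/norP => -[]; exact: c1.
  have : (2 == s) || (2 == t) by apply/norP => -[]; exact: c2.
  lia.
have q2 : q i = 2 by have := q_gt1 i; lia.
rewrite q2 in hs ht sq tq no.
have st : s != t.
  apply/eqP => st; have := no (s.+1 %% 2); rewrite modn_mod -st.
  have {}sq : s = 0 \/ s = 1 by lia.
  by case: sq => ->; apply => //; lia.
apply/imsetP; exists (if s == 0 then (b, c) else (c, b)) => //.
apply: (@eq_tuple_nth _ a0) => x xn.
rewrite (nth_mktuple_nat _ (fun x => if odd x then (if s == 0 then (b, c) else (c, b)).1
   else (if s == 0 then (b, c) else (c, b)).2)) //.
have hb : x %% 2 != s -> nth a0 u x = b.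
  by move=> h; apply/eqP; apply: contraNT h => /(hs _ xn)->.
have hc : x %% 2 != t -> nth a0 u x = c.
  by move=> h; apply/eqP; apply: contraNT h => /(ht _ xn)->.
rewrite modn2 in hb hc.
have [s0|s0] := eqVneq s 0; case: (odd x) hb hc => /= hb hc; by [apply: hb; lia | apply: hc; lia].
Qed.

Lemma layered_inv n (f : nat -> A) : layered q n f -> 1 < n ->
  exists b i s, s < q i /\ forall x, x < n -> f x != b -> x %% q i = s.
Proof.
case=> {n f} [n f n1|n f i s b sq hb _ _]; first by rewrite ltnNge n1.
by exists b, i, s; split=> // x xn; apply: contraNeq => /(hb _ xn) ->.
Qed.

Lemma layered_has_background n (u : n.-tuple A) : 1 < n -> u \in layered_words n ->
  exists b i, has_background i b u.
Proof.
rewrite inE => n1 /asboolP /layered_inv/(_ n1) [b [i [s [sq h]]]].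
by exists b, i; apply/existsP; exists (Ordinal sq); apply/backgroundP.
Qed.

(** Off the alternating words the background letter is unique, and [u] is fresh exactly for the
    other letters. *)
Lemma fresh_last n (u : n.-tuple A) : background_bound <= n -> u \in layered_words n ->
  u \notin [set alternating n p | p : A * A] ->
  \sum_(b : A) (u \in fresh k b n) = #|A|.-1.
Proof.
move=> nb ul ue; have n1 : 1 < n by move: nb; rewrite /background_bound; lia.
have [b [i hi]] := layered_has_background n1 ul.
rewrite (bigD1 b) //= finset.in_set ul /= (_ : [forall _, _] = false); last first.
  by apply/negP => /forallP/(_ i); rewrite ltn_ord hi.
rewrite andbF add0n (eq_bigr (fun=> 1)) ?sum1_card.
  by rewrite cardC1.
move=> c cb; rewrite finset.in_set ul /=; apply/eqP; rewrite eqb1; apply/andP; split.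
  apply: contra ue => /eqP->; apply/imsetP; exists (c, c) => //.
  apply: (@eq_tuple_nth _ a0) => x xn; rewrite (nth_mktuple_nat _ (fun=> c)) //.
  by rewrite (nth_mktuple_nat _ (fun x => if odd x then c else c)) // if_same.
apply/forallP => l; apply/implyP => _; apply: contra ue => hl.
exact: has_background_uniq nb hl hi cb.
Qed.

(** By [fresh_last] the two sides differ only on alternating words: at most [#|A| ^ 2] of them, each
    contributing at most [#|A|]. *)
Lemma fresh_count_last n : background_bound <= n ->
  fresh_count k n <= #|A|.-1 * #|layered_words n| + #|A| ^ 3 /\
  #|A|.-1 * #|layered_words n| <= fresh_count k n + #|A| ^ 3.
Proof.
move=> nb; set E := [set alternating n p | p : A * A].
have cE : #|E| * #|A| <= #|A| ^ 3.
  rewrite (expnS _ 2) mulnC leq_mul2l; apply/orP; right.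
  by apply: leq_trans (leq_imset_card _ _) _; rewrite card_prod mulnn.
have -> : fresh_count k n = \sum_(u in layered_words n) \sum_b (u \in fresh k b n).
  rewrite exchange_big /=; apply: eq_bigr => b _.
  rewrite -sum1_card big_mkcond [RHS]big_mkcond; apply: eq_bigr => u _.
  by rewrite finset.in_set; case: (u \in layered_words n) => //=; case: ifP.
have -> : #|A|.-1 * #|layered_words n| = \sum_(u in layered_words n) #|A|.-1.
  by rewrite sum_nat_const mulnC.
have le_E F G : (forall u, u \in layered_words n -> u \notin E -> F u = G u) ->
    (forall u, F u <= #|A|) ->
    \sum_(u in layered_words n) F u <= \sum_(u in layered_words n) G u + #|A| ^ 3.
  move=> FG FA; apply: leq_trans (leq_add (leqnn _) cE); rewrite -sum_nat_const.
  apply: (@leq_trans (\sum_(u in layered_words n) (G u + if u \in E then #|A| else 0))).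
    apply: leq_sum => u ul; case: ifP => uE; last by rewrite addn0 FG ?uE.
    exact: leq_trans (FA u) (leq_addl _ _).
  rewrite big_split leq_add2l -big_mkcondr !sum_nat_const leq_mul2r.
  by rewrite subset_leq_card ?orbT //; apply/fintype.subsetP => u /andP[].
have bE u : \sum_b (u \in fresh k b n) <= #|A|.
  by rewrite -sum1_card leq_sum // => b _; case: (_ \in _).
split; apply: le_E => // u; rewrite ?leq_pred //; first exact: fresh_last.
by move=> ul ue; rewrite fresh_last.
Qed.

Lemma layered_words_ge (i0 : 'I_k) n : 1 < #|A| -> n <= #|layered_words n|.
Proof.
move=> A2; have /card_gt0P[a1] : 0 < #|predC1 a0| by rewrite cardC1; lia.
rewrite inE /= => a10.
pose f (y : 'I_n) : n.-tuple A := [tuple if (x : nat) == y then a1 else a0 | x < n].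
have fE y x : x < n -> nth a0 (f y) x = if x == y then a1 else a0.
  by move=> xn; rewrite (nth_mktuple_nat _ (fun x => if x == y then a1 else a0)).
have f_inj : injective f.
  move=> y z /(congr1 (fun u : n.-tuple A => nth a0 u y)); rewrite !fE // eqxx.
  by case: eqP => [/val_inj//|_ e]; rewrite e eqxx in a10.
rewrite -{1}(card_ord n) -(card_imset _ f_inj); apply/subset_leq_card/fintype.subsetP.
move=> _ /imsetP[y _ ->]; rewrite inE; apply/asboolP.
apply: (@eq_layered _ _ q n (fun x => if x == y then a1 else a0)).
  by move=> x xn; rewrite fE.
by apply: (@layered_single _ _ q q_prime n a0 i0 y) => x; case: eqP.
Qed.

(** A crude divergence of the counts, from which the comparison with a subsolution starts. Passing
    from [j] to [k] only removes words. *)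
Lemma fresh_count_ge (i0 : 'I_k) j n : 1 < #|A| -> j <= k -> background_bound <= n ->
  n <= fresh_count j n + #|A| ^ 3.
Proof.
move=> A2 jk nb; have [_ h] := fresh_count_last nb.
have h1 := layered_words_ge i0 n A2.
have h2 : fresh_count k n <= fresh_count j n.
  rewrite -(leq_add2r (\sum_(i < k | i < k) class_sum i n + #|A|)).
  rewrite addnA (fresh_countE i0) // -(fresh_countE i0 _ jk) -addnA leq_add2l leq_add2r.
  by rewrite big_mkcond [X in _ <= X]big_mkcond leq_sum // => i _; case: ifP; rewrite // ltn_ord.
apply: leq_trans (leq_trans _ h) _; last by rewrite leq_add2r.
by apply: leq_trans h1 _; rewrite leq_pmull //; lia.
Qed.

Local Open Scope ring_scope.

(** Let a be the number of layered words, S and S_j the sums of [class_sum] up to k and up to j.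
    [fresh_countE] at [k] and [fresh_count_last] give a = S + O(1); [fresh_countE] at [j] then gives
    A_j = d S - S_j + O(1). *)
Lemma fresh_count_rec (R : realDomainType) (j : 'I_k) n : (background_bound <= n)%N ->
  `|(fresh_count j n)%:R - \sum_(i < k) (#|A|%:R - (i < j)%N%:R) *
      \sum_(s < q i) (fresh_count i (class_size n (q i) s))%:R| <= (#|A| ^ 2 + #|A| ^ 4)%:R :> R.
Proof.
move=> nb; have [h1 h2] := fresh_count_last nb.
have ek := fresh_countE j n (leqnn k); have ej := fresh_countE j n (ltnW (ltn_ord j)).
have -> : \sum_(i < k) (#|A|%:R - (i < j)%N%:R) *
      \sum_(s < q i) (fresh_count i (class_size n (q i) s))%:R
    = #|A|%:R * (\sum_(i < k | (i < k)%N) class_sum i n)%:R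
      - (\sum_(i < k | (i < j)%N) class_sum i n)%:R :> R.
  rewrite !natr_sum mulr_sumr [in RHS]big_mkcond [X in _ - X]big_mkcond -sumrB.
  apply: eq_bigr => i _; rewrite ltn_ord /class_sum natr_sum mulrBl.
  by case: ifP => _; rewrite ?mul1r ?mul0r.
move: ek ej h1 h2; rewrite -[#|layered_words n|]/(#|layered_words n|).
set a := #|layered_words n|; set S := \sum_(i < k | _) _; set Sj := \sum_(i < k | _) _.
set d := #|A|.
have d0 : (0 < d)%N by apply/card_gt0P; exists a0.
move=> ek ej h1 h2.
have ekR : (fresh_count k n)%:R + S%:R + d%:R = d%:R * a%:R :> R by rewrite -!natrD ek natrM.
have ejR : (fresh_count j n)%:R + Sj%:R + d%:R = d%:R * a%:R :> R by rewrite -!natrD ej natrM.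
have dR : (d.-1)%:R = d%:R - 1 :> R by rewrite -subn1 natrB.
have h1R : (fresh_count k n)%:R <= (d%:R - 1) * a%:R + d%:R ^+ 3 :> R.
  by rewrite -dR -natrX -natrM -natrD ler_nat.
have h2R : (d%:R - 1) * a%:R <= (fresh_count k n)%:R + d%:R ^+ 3 :> R.
  by rewrite -dR -natrX -natrM -natrD ler_nat.
have d1 : 1 <= d%:R :> R by rewrite ler1n.
have -> : (fresh_count j n)%:R - (d%:R * S%:R - Sj%:R)
  = d%:R ^+ 2 - d%:R + d%:R * ((fresh_count k n)%:R - (d%:R - 1) * a%:R) :> R.
  have -> : (fresh_count k n)%:R = d%:R * a%:R - S%:R - d%:R :> R by rewrite -ekR; ring.
  have -> : (fresh_count j n)%:R = d%:R * a%:R - Sj%:R - d%:R :> R by rewrite -ejR; ring.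
  ring.
have e4 : (d ^ 2 + d ^ 4)%:R = d%:R ^+ 2 + d%:R * d%:R ^+ 3 :> R.
  by rewrite natrD !natrX -exprS.
rewrite e4; apply: le_trans (ler_normD _ _) _; rewrite lerD //.
  rewrite ger0_norm; last by rewrite subr_ge0 expr2 ler_pMl // (lt_le_trans ltr01).
  by rewrite gerBl (le_trans ler01).
rewrite normrM ger0_norm ?(le_trans ler01) // ler_wpM2l ?(le_trans ler01) //.
by rewrite ler_norml lerBlDl h1R lerBrDl andbT lerBlDr.
Qed.

End Counting.

Local Open Scope classical_set_scope.
Local Open Scope ring_scope.

(** * Density of the products of powers of two primes *)

Section Density.
Variable R : realType.
Implicit Types (lam mu eta t : R).

Lemma truncn_div_itv (x y : R) : 0 <= x -> 0 < y ->
  (Num.truncn (x / y))%:R * y <= x < (Num.truncn (x / y)).+1%:R * y.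
Proof.
move=> x0 y0; have := truncn_itv (divr_ge0 x0 (ltW y0)).
by rewrite ler_pdivlMr // ltr_pdivrMr.
Qed.

(* Pigeonhole on the residues of the multiples of lam modulo mu. *)
Lemma small_combination lam mu eta : 0 < lam -> 0 < mu -> 0 < eta ->
  (forall a b : nat, a%:R * lam = b%:R * mu -> a = 0%N) ->
  exists a b : nat, 0 < `|a%:R * lam - b%:R * mu| < eta.
Proof.
move=> lam0 mu0 eta0 irr.
pose b (a : nat) := Num.truncn (a%:R * lam / mu).
pose v a : R := a%:R * lam - (b a)%:R * mu.
have vP a : 0 <= v a < mu.
  have /andP[h1 h2] := truncn_div_itv (mulr_ge0 (ler0n R a) (ltW lam0)) mu0.
  by rewrite -/(b a) -natr1 in h1 h2; rewrite /v; lra.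
pose c a := Num.truncn (v a / eta).
have cP a : (c a)%:R * eta <= v a < (c a)%:R * eta + eta.
  have /andP[v0 _] := vP a; have := truncn_div_itv v0 eta0.
  by rewrite -/(c a) -natr1 mulrDl mul1r.
pose K := (Num.truncn (mu / eta)).+1.
have cK a : (c a < K)%N.
  rewrite ltnS; apply: le_truncn; rewrite ler_pM2r ?invr_gt0 //.
  by have /andP[_ /ltW] := vP a.
have : ~ injective (fun a : 'I_K.+1 => Ordinal (cK a)).
  by move=> /leq_card; rewrite !card_ord ltnn.
move=> ninj; have [a1 [a2 [a12 e12]]] : exists a1 a2, (a1 < a2)%N /\ c a1 = c a2.
  apply: contrapT => H; apply: ninj => x y /(congr1 val) /= exy; apply: val_inj => /=.
  case: (ltngtP x y) => // xy; case: H; first by exists x, y.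
  by exists y, x.
have b12 : (b a1 <= b a2)%N.
  apply: le_truncn; rewrite ler_pM2r ?invr_gt0 // ler_pM2r // ler_nat; exact: ltnW.
exists (a2 - a1)%N, (b a2 - b a1)%N; rewrite normr_gt0; apply/andP; split.
  by apply/eqP => /eqP; rewrite subr_eq0 => /eqP /irr /eqP; rewrite subn_eq0 leqNgt a12.
rewrite (natrB _ (ltnW a12)) (natrB _ b12).
have := cP a1; have := cP a2; rewrite e12 /v => /andP[h1 h2] /andP[h3 h4].
by rewrite ltr_norml; apply/andP; split; lra.
Qed.

(** From the largest multiple of [mu] below [t], each exchange of [b] copies of [mu] for [a] copies
    of [lam] moves up by less than [eta]. *)
Lemma dense_of_small_step lam mu eta (a b : nat) : 0 < lam -> 0 < mu ->
  0 < a%:R * lam - b%:R * mu < eta ->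
  exists t0, forall t, t0 <= t ->
    exists c d : nat, t <= c%:R * lam + d%:R * mu <= t + eta.
Proof.
set theta := _ - _ => lam0 mu0 /andP[th0 th_eta].
pose J0 := (Num.truncn (mu / theta)).+1.
(* Beyond this point there are enough copies of [mu] for the at most [J0] exchanges required. *)
exists ((J0 * b).+1%:R * mu) => t ht.
have t0 : 0 <= t by apply: le_trans ht; rewrite mulr_ge0 // ltW.
pose B := Num.truncn (t / mu).
have /andP[B1 B2] := truncn_div_itv t0 mu0; rewrite -/B in B1 B2.
pose r := t - B%:R * mu.
have r0 : 0 <= r by rewrite /r; lra.
pose J := (Num.truncn (r / theta)).+1.
have /andP[J1 J2] := truncn_div_itv r0 th0.
have JJ0 : (J <= J0)%N.
  rewrite ltnS; apply: le_truncn; rewrite ler_pM2r ?invr_gt0 // /r.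
  by rewrite -natr1 in B2; lra.
have JB : (J * b <= B)%N.
  apply: (@leq_trans (J0 * b)%N); first by rewrite leq_mul2r JJ0 orbT.
  rewrite -ltnS -(ltr_nat R) -(ltr_pM2r mu0);
  by apply: le_lt_trans B2; apply: le_trans ht; rewrite ler_pM2r // ler_nat.
exists (J * a)%N, (B - J * b)%N; rewrite natrB // !natrM.
have -> : J%:R * a%:R * lam + (B%:R - J%:R * b%:R) * mu = B%:R * mu + J%:R * theta.
  by rewrite /theta; ring.
rewrite -/J in J2; rewrite /r in J1 J2; move: J1 J2; rewrite /J -natr1; lra.
Qed.

Lemma nat_combinations_dense lam mu eta : 0 < lam -> 0 < mu -> 0 < eta ->
  (forall a b : nat, a%:R * lam = b%:R * mu -> a = 0%N) ->
  exists t0, forall t, t0 <= t ->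
    exists c d : nat, t <= c%:R * lam + d%:R * mu <= t + eta.
Proof.
move=> lam0 mu0 eta0 irr.
have [a [b]] := small_combination lam0 mu0 eta0 irr.
case: (ler0P (a%:R * lam - b%:R * mu)) => [h|h] h'; last exact: dense_of_small_step lam0 mu0 h'.
rewrite opprB in h'; have [t0 H] := dense_of_small_step mu0 lam0 h'.
by exists t0 => t /H[c [d hcd]]; exists d, c; rewrite addrC.
Qed.

(** After taking logarithms, unique factorization makes [ln p] and [ln r] independent. *)
Lemma prime_power_products_dense (p r : nat) eta : prime p -> prime r -> p != r ->
  0 < eta ->
  exists y0 : R, forall y, y0 <= y ->
    exists a b : nat, y <= (p ^ a * r ^ b)%:R <= (1 + eta) * y.
Proof.
move=> pp pr npr eta0.
have ln0 (s : nat) : prime s -> 0 < ln (s%:R : R).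
  by move=> ps; rewrite ln_gt0 // ltr1n prime_gt1.
have lnX (s a : nat) : prime s -> ln ((s ^ a)%:R : R) = a%:R * ln (s%:R : R).
  by move=> ps; rewrite natrX lnXn ?ltr0n ?prime_gt0 // mulr_natl.
have eta1 : 0 < ln (1 + eta) by rewrite ln_gt0 // ltrDl.
have [a b e|t0 H] := nat_combinations_dense (ln0 _ pp) (ln0 _ pr) eta1.
  rewrite -!lnX // in e.
  have /eqP : ((p ^ a)%:R : R) = (r ^ b)%:R.
    by apply: ln_inj e; rewrite posrE ltr0n expn_gt0 prime_gt0.
  rewrite eqr_nat => /eqP/(congr1 (logn p)).
  by rewrite pfactorK // lognX logn_prime // (negbTE npr) muln0.
exists (expR t0) => y hy.
have y0 : 0 < y by apply: lt_le_trans hy; apply: expR_gt0.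
have ly : t0 <= ln y by rewrite -[t0]expRK ler_ln ?posrE ?expR_gt0.
have [a [b hab]] := H _ ly; exists a, b.
have pos : 0 < (p ^ a * r ^ b)%:R :> R by rewrite ltr0n muln_gt0 !expn_gt0 !prime_gt0.
have pa : ((p ^ a)%:R : R) \is Num.pos by rewrite posrE ltr0n expn_gt0 prime_gt0.
have rb : ((r ^ b)%:R : R) \is Num.pos by rewrite posrE ltr0n expn_gt0 prime_gt0.
have e1 : ln ((p ^ a * r ^ b)%:R : R) = a%:R * ln (p%:R : R) + b%:R * ln (r%:R : R).
  by rewrite natrM lnM // !lnX.
have pe : 0 < (1 + eta) * y by rewrite mulr_gt0 // addr_gt0.
by rewrite -[y <= _]ler_ln ?posrE // -[_ <= _ * y]ler_ln ?posrE // e1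
  [ln (_ * y)]lnM ?posrE // ?addr_gt0 // [ln _ + ln y]addrC.
Qed.

End Density.

(** * A limit theorem for renewal recurrences *)

Section RenewalLimit.
Variables (R : realType) (I : finType) (p : I -> I -> R) (q : I -> nat) (K : R) (N0 : nat).
Variable F : I -> nat -> R.
Hypothesis p_gt0 : forall j i, 0 < p j i.
Hypothesis p_sum : forall j, \sum_i p j i = 1.
Hypothesis q_ge2 : forall i, (2 <= q i)%N.
Hypothesis K_gt0 : 0 < K.
Hypothesis F_rec : forall j n, (N0 <= n)%N ->
  `|F j n - \sum_i p j i * F i (n %/ q i)| <= K / n%:R.
Hypothesis F_step : forall j n, (0 < n)%N -> `|F j n.+1 - F j n| <= K / n%:R.

Lemma nat_above (x : R) : exists n : nat, x <= n%:R.
Proof. by exists (Num.truncn x).+1; apply/ltW/truncnS_gt. Qed.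

Lemma small_inv (C eps : R) : 0 < eps ->
  exists N : nat, forall n, (N <= n)%N -> (0 < n)%N /\ C / n%:R <= eps.
Proof.
move=> e0; have [N hN] := nat_above (C / eps); exists N.+1 => n hn.
have n0 : (0 < n)%N by apply: leq_trans hn.
split=> //; rewrite ler_pdivrMr ?ltr0n // mulrC -ler_pdivrMr //.
by apply: le_trans hN _; rewrite ler_nat ltnW.
Qed.

Lemma F_var j m n : (0 < m <= n)%N -> `|F j n - F j m| <= K * (n - m)%:R / m%:R.
Proof.
move=> /andP[m0]; elim: n => [|n IH]; first by lia.
rewrite leq_eqVlt => /orP[/eqP->|]; first by rewrite subrr normr0 subnn mulr0 mul0r.
rewrite ltnS => mn; rewrite subSn // -natr1 mulrDr mulrDl.
have -> : F j n.+1 - F j m = (F j n - F j m) + (F j n.+1 - F j n) by ring.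
apply: le_trans (ler_normD _ _) _; apply: lerD; first exact: IH.
apply: le_trans (F_step _ _) _; first exact: leq_trans mn.
by rewrite mulr1 ler_pM2l // lef_pV2 ?posrE ?ltr0n ?ler_nat //; apply: leq_trans mn.
Qed.

Let qm := (\max_i q i)%N.
Let q_le i : (q i <= qm)%N. Proof. exact: leq_bigmax. Qed.

(* The term K / z absorbs the error of the recurrence, as z %/ q <= z / 2. *)
Lemma lower_barrier (L0 : R) x : (N0 <= x)%N -> (0 < x)%N ->
  (forall j z, (x <= z < qm * x)%N -> L0 <= F j z) ->
  forall j z, (x <= z)%N -> L0 - K / x%:R + K / z%:R <= F j z.
Proof.
move=> Nx x0 hL j z; elim/ltn_ind: z j => z IH j xz.
have z0 : (0 < z)%N by apply: leq_trans xz.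
have [zx|zx] := ltnP z (qm * x).
  apply: le_trans (hL j z _); last by rewrite xz.
  have : K / z%:R <= K / x%:R by rewrite ler_pM2l // lef_pV2 ?posrE ?ltr0n ?ler_nat.
  lra.
have := F_rec j (leq_trans Nx xz); rewrite ler_norml => /andP[h _].
have : \sum_i p j i * (L0 - K / x%:R + 2%:R * (K / z%:R)) <= \sum_i p j i * F i (z %/ q i).
  apply: ler_sum => i _; rewrite ler_pM2l //.
  have xzi : (x <= z %/ q i)%N.
    rewrite leq_divRL; last exact: leq_trans (q_ge2 i).
    by apply: leq_trans zx; rewrite mulnC leq_mul2r q_le orbT.
  have zi0 : (0 < z %/ q i)%N by apply: leq_trans xzi.
  apply: le_trans (IH _ _ i xzi); last by rewrite ltn_Pdiv //; apply: q_ge2.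
  rewrite lerD2l mulrCA ler_pM2l // ler_pdivrMr ?ltr0n // [leRHS]mulrC ler_pdivlMr ?ltr0n //.
  rewrite -natrM ler_nat; apply: leq_trans (leq_mul _ (leqnn _)) _; first exact: q_ge2 i.
  by rewrite mulnC leq_trunc_div.
rewrite -mulr_suml p_sum mul1r => h'.
by lra.
Qed.

(** The infimum of such [x] is the limsup of F, taken jointly over all indices. *)
Definition asymptotic_bound (x : R) : Prop :=
  exists N : nat, forall n, (N <= n)%N -> forall j, F j n <= x.

(** * Propagation of values near the limsup *)

Section AtLimsup.
Variable M : R.
Hypothesis M_above : forall eps, 0 < eps -> asymptotic_bound (M + eps).
Hypothesis M_below : forall eps, 0 < eps -> ~ asymptotic_bound (M - eps).

(* A convex combination can only be near the limsup if all its terms are. *)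
Lemma near_max_step eps : 0 < eps ->
  exists delta : R, 0 < delta /\ exists N : nat, forall n, (N <= n)%N -> forall j i,
    M - delta <= F j n -> M - eps <= F i (n %/ q i).
Proof.
move=> e0.
have [pm pm0 hpm] : exists2 pm : R, 0 < pm & forall j i, pm <= p j i.
  exists (\big[Num.min/1]_(ji : I * I) p ji.1 ji.2).
    by apply: lt_bigmin.
  by move=> j i; apply: (bigmin_le_cond _ (j:=(j, i))).
pose delta := eps * pm / 3%:R.
have d0 : 0 < delta by rewrite divr_gt0 // mulr_gt0.
have [N1 hN1] := M_above d0; have [N2 hN2] := small_inv K d0.
exists delta; split=> //; exists (maxn N0 (maxn N2 (qm * N1))) => n.
rewrite !geq_max => /and3P[nN0 nN2 nN1] j i hj.
have [n0 Kn] := hN2 _ nN2.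
have up l : F l (n %/ q l) <= M + delta.
  apply: hN1; rewrite leq_divRL; last exact: leq_trans (q_ge2 l).
  by apply: leq_trans nN1; rewrite mulnC leq_mul2r q_le orbT.
have := F_rec j nN0; rewrite ler_norml => /andP[_ h].
rewrite (bigD1 i) //= in h.
have h2 : \sum_(l | l != i) p j l * F l (n %/ q l) <= (1 - p j i) * (M + delta).
  have e := p_sum j; rewrite (bigD1 i) //= in e.
  have -> : 1 - p j i = \sum_(l | l != i) p j l by rewrite -e addrAC subrr add0r.
  rewrite mulr_suml.
  by apply: ler_sum => l _; rewrite ler_pM2l.
have pji := p_gt0 j i.
have h3 : p j i * M - 3%:R * delta <= p j i * F i (n %/ q i).
  have : 0 <= p j i * delta by rewrite mulr_ge0 // ltW.
  lra.
rewrite -(ler_pM2l pji); apply: le_trans h3.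
have -> : 3%:R * delta = eps * pm by rewrite mulrC divfK ?pnatr_eq0.
by rewrite mulrBr lerD2l lerN2 [leRHS]mulrC ler_pM2l.
Qed.

Lemma near_max_path (s : seq I) eps : 0 < eps ->
  exists delta : R, 0 < delta /\ exists N : nat, forall n, (N <= n)%N -> forall j,
    M - delta <= F j n -> M - eps <= F (last j s) (n %/ \prod_(i <- s) q i).
Proof.
elim: s eps => [|i s IH] eps e0.
  by exists eps; split=> //; exists 0%N => n _ j; rewrite big_nil divn1.
have [d1 [d10 [N1 h1]]] := IH _ e0.
have [d2 [d20 [N2 h2]]] := near_max_step d10.
exists d2; split=> //; exists (maxn N2 (N1 * q i)) => n; rewrite geq_max => /andP[n2 n1] j hj.
rewrite big_cons divnMA; apply: h1; last exact: h2 hj.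
by rewrite leq_divRL //; apply: leq_trans (q_ge2 i).
Qed.

Lemma near_max_paths (ss : seq (seq I)) eps : 0 < eps ->
  exists delta : R, 0 < delta /\ exists N : nat, forall n, (N <= n)%N -> forall j,
    M - delta <= F j n ->
    forall s, s \in ss -> M - eps <= F (last j s) (n %/ \prod_(i <- s) q i).
Proof.
move=> e0; elim: ss => [|s ss [d1 [d10 [N1 h1]]]].
  by exists 1; split=> //; exists 0%N.
have [d2 [d20 [N2 h2]]] := near_max_path s e0.
exists (Num.min d1 d2); split; first by rewrite lt_min d10.
exists (maxn N1 N2) => n; rewrite geq_max => /andP[n1 n2] j hj s'.
have m1 : Num.min d1 d2 <= d1 by rewrite ge_min lexx.
have m2 : Num.min d1 d2 <= d2 by rewrite ge_min lexx orbT.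
by rewrite inE => /orP[/eqP->|hs]; [apply: h2|apply: h1] => //; lra.
Qed.

Variables (i1 i2 : I).
Hypothesis products_dense : forall eta, 0 < eta -> exists y0 : R, forall y, y0 <= y ->
  exists a b : nat, y <= (q i1 ^ a * q i2 ^ b)%:R <= (1 + eta) * y.

(** From a large [n] with F near [M], descend by [a] steps [i1], [b] steps [i2] and a last step [j].
    This reaches index [j] at z' = n %/ (g q_j); density allows a g for which z' is just below [z],
    and [F_var] carries the bound from z' to [z]. *)
Lemma near_max_interval eps X : 0 < eps ->
  exists x, (X <= x)%N /\ forall j z, (x <= z < qm * x)%N -> M - eps <= F j z.
Proof.
move=> e0.
have [eta [eta0 eta1 eta_eps]] : exists eta : R, [/\ 0 < eta, eta <= 1 & K * eta <= eps / 4%:R].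
  exists (Num.min 1 (eps / 4%:R / K)).
  have h0 : 0 < eps / 4%:R / K by rewrite !divr_gt0.
  rewrite lt_min ltr01 h0 ge_min lexx; split=> //.
  by rewrite mulrC -ler_pdivlMr // ge_min lexx orbT.
have [y0 hy0] := products_dense eta0.
have [Y0 hY0] := nat_above y0.
have qm2 : (2 <= qm)%N by apply: leq_trans (q_ge2 i1) (q_le i1).
(* With n/x about [Y], the two factors [qm], which bound z/x and q_j, keep n/(z q_j) above [y0]. *)
pose Y := (Y0.+1 * qm * qm)%N.
have Y_gt0 : (0 < Y)%N by rewrite !muln_gt0 /= !(leq_trans _ qm2).
(* As g <= (1 + eta) y <= 2 Y, all exponents are below [T], so a finite list of paths can be fixed
   before [n]. *)
pose T := (2 * Y).+1.
pose ss := [seq nseq ab.1 i1 ++ nseq ab.2 i2 ++ [:: j] |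
  ab <- [seq (a, b) | a <- iota 0 T, b <- iota 0 T], j <- enum I].
have e20 : 0 < eps / 2%:R by rewrite divr_gt0.
have [delta [d0 [N hN]]] := near_max_paths ss e20.
have [N2 hN2] := small_inv (2%:R * K) (divr_gt0 e0 (ltr0n R 4)).
pose Z := (X + N2.+1 * 2 + 2)%N.
have [n [nN [j0 hj0]]] : exists n, (maxn N (Z * Y) <= n)%N /\ exists j, M - delta <= F j n.
  apply: contrapT => H; apply: (M_below d0); exists (maxn N (Z * Y)) => n hn j.
  rewrite leNgt; apply/negP => /ltW hj; apply: H; exists n; split=> //; by exists j.
move: nN; rewrite geq_max => /andP[nN nZ].
pose x := (n %/ Y)%N.
have Zx : (Z <= x)%N by rewrite leq_divRL.
have x0 : (0 < x)%N by apply: leq_trans Zx; rewrite /Z addn2.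
exists x; split; first by apply: leq_trans Zx; rewrite /Z -addnA leq_addr.
move=> j z /andP[xz zx].
have z0 : (0 < z)%N by apply: leq_trans xz.
have n1 : (x * Y <= n)%N by apply: leq_trunc_div.
have n2 : (n <= 2 * x * Y)%N.
  have := ltn_ceil n Y_gt0; rewrite -/x => h; apply: ltnW; apply: leq_trans h _.
  by rewrite leq_mul2r mul2n -addnn -addn1 leq_add2l x0 orbT.
have qj0 : (0 < q j)%N by apply: leq_trans (q_ge2 j).
have zq0 : 0 < (z * q j)%:R :> R by rewrite ltr0n muln_gt0 z0.
pose y : R := n%:R / (z * q j)%:R.
have yE : y * (z * q j)%:R = n%:R by rewrite divfK // gt_eqF.
have y0y : y0 <= y.
  rewrite ler_pdivlMr //; apply: (@le_trans _ _ (Y0 * (z * q j))%:R).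
    by rewrite [leRHS]natrM ler_wpM2r // ltW.
  rewrite ler_nat; apply: leq_trans n1; rewrite /Y.
  apply: (@leq_trans (Y0.+1 * (qm * x * qm))); last first.
    by rewrite [leqRHS]mulnC -!mulnA [(x * _)%N]mulnC !mulnA.
  by apply: leq_mul => //; apply: leq_mul => //; apply: ltnW.
have yY : y <= Y%:R.
  rewrite ler_pdivrMr // -natrM ler_nat; apply: leq_trans n2 _.
  rewrite mulnC; apply: leq_mul => //; rewrite mulnC; exact: leq_mul.
have [a [b /andP[g1 g2]]] := hy0 _ y0y.
set g := (q i1 ^ a * q i2 ^ b)%N in g1 g2.
have gT : (g < T)%N.
  rewrite ltnS -(ler_nat R); apply: le_trans g2 _; rewrite natrM.
  apply: ler_pM => //; first by rewrite addr_ge0 // ltW.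
  - by rewrite divr_ge0.
  - by rewrite -[2%:R]/(1 + 1) lerD2l.
have exp_lt (i : I) (c : nat) : (c < q i ^ c)%N by apply: ltn_expl; apply: q_ge2.
have g0 (i : I) (c : nat) : (0 < q i ^ c)%N by rewrite expn_gt0 (leq_trans _ (q_ge2 i)).
have aT : (a < T)%N.
  by apply: leq_trans (exp_lt i1 a) (leq_trans _ (ltnW gT)); rewrite leq_pmulr.
have bT : (b < T)%N.
  by apply: leq_trans (exp_lt i2 b) (leq_trans _ (ltnW gT)); rewrite leq_pmull.
have := hN n nN j0 hj0 (nseq a i1 ++ nseq b i2 ++ [:: j]).
have -> : nseq a i1 ++ nseq b i2 ++ [:: j] \in ss.
  apply/allpairsPdep; exists (a, b), j; rewrite mem_enum; split=> //.
  by apply/allpairsPdep; exists a, b; rewrite !mem_iota.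
move=> /(_ isT); rewrite !big_cat big_seq1 !last_cat /= !big_nseq !iter_muln_1 mulnA -/g.
set z' := (n %/ _)%N => hz'.
have gq0 : (0 < g * q j)%N by rewrite !muln_gt0 !g0.
have z'z : (z' <= z)%N.
  rewrite -ltnS ltn_divLR // -(ltr_nat R) -yE.
  apply: (@lt_le_trans _ _ (y * (z.+1 * q j)%:R)).
    rewrite ltr_pM2l ?ltr_nat ?ltn_mul2r ?qj0 //= divr_gt0 // ltr0n (leq_trans _ nZ) //.
    by rewrite muln_gt0 Y_gt0 /Z addn2.
  have -> : (z.+1 * (g * q j))%:R = g%:R * (z.+1 * q j)%:R :> R by rewrite !natrM; ring.
  by rewrite ler_wpM2r.
have z1 : z%:R <= (1 + eta) * z'.+1%:R :> R.
  rewrite -(ler_pM2l (_ : 0 < y * (q j)%:R)); last first.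
    by rewrite mulr_gt0 ?ltr0n // divr_gt0 // ltr0n (leq_trans _ nZ) // muln_gt0 Y_gt0 /Z addn2.
  rewrite -mulrA [_ * z%:R]mulrC -natrM yE.
  have := ltn_ceil n gq0; rewrite -/z' -(ltr_nat R) => /ltW h; apply: le_trans h _.
  have -> : y * (q j)%:R * ((1 + eta) * z'.+1%:R) = ((1 + eta) * y) * (q j * z'.+1)%:R.
    by rewrite natrM; ring.
  have -> : (z'.+1 * (g * q j))%:R = g%:R * (q j * z'.+1)%:R :> R by rewrite !natrM; ring.
  by rewrite ler_wpM2r.
have zz : (Z <= z)%N by apply: leq_trans Zx xz.
have z'big : (N2 <= z')%N.
  apply: ltnW; rewrite -ltnS -(ltr_nat R).
  have h1 : (1 + eta) * z'.+1%:R <= 2 * z'.+1%:R :> R.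
    by rewrite ler_wpM2r // -[2]/(1 + 1) lerD2l.
  have h2 : (N2.+1 * 2)%:R < z%:R :> R.
    by rewrite ltr_nat; apply: leq_trans zz; rewrite /Z addn2 ltnS ltnW // ltnS leq_addl.
  rewrite natrM mulrC in h2.
  by rewrite -(ltr_pM2l (ltr0n R 2)); exact: lt_le_trans h2 (le_trans z1 h1).
have [z'0 hz'K] := hN2 _ z'big.
have z'0R : 0 < z'%:R :> R by rewrite ltr0n.
have := @F_var j z' z; rewrite z'0 z'z => /(_ isT); rewrite ler_norml => /andP[hv _].
(* Of the budget [eps], half is spent on the path and a quarter each on rounding and on [eta]. *)
have : K * (z - z')%:R / z'%:R <= 2%:R * K / z'%:R + K * eta.
  rewrite ler_pdivrMr // mulrDl divfK ?gt_eqF // natrB //.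
  have : K * z%:R <= K * ((1 + eta) * z'.+1%:R) by rewrite ler_pM2l.
  have : K * eta <= K by rewrite ger_pMr.
  by rewrite -natr1; lra.
lra.
Qed.

End AtLimsup.

Lemma renewal_limit (i1 i2 : I) (B : R) :
  (forall eta, 0 < eta -> exists y0 : R, forall y, y0 <= y ->
    exists a b : nat, y <= (q i1 ^ a * q i2 ^ b)%:R <= (1 + eta) * y) ->
  (forall j n, `|F j n| <= B) ->
  exists M : R, forall eps, 0 < eps -> exists N : nat, forall n, (N <= n)%N ->
    forall j, `|F j n - M| <= eps.
Proof.
move=> dense bnd; pose S : set R := asymptotic_bound.
have S_lb : lbound S (- B).
  move=> x [N hN]; have := bnd i1 N; rewrite ler_norml => /andP[h _].
  exact: le_trans h (hN N (leqnn _) i1).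
have S_inf : has_inf S.
  split; last by exists (- B).
  by exists B, 0%N => n _ j; have := bnd j n; rewrite ler_norml => /andP[].
pose M := inf S.
have M_above eps : 0 < eps -> asymptotic_bound (M + eps).
  move=> e0; have [x [N hN] xM] := inf_adherent e0 S_inf.
  by exists N => n /hN h j; apply: le_trans (h j) (ltW xM).
have M_below eps : 0 < eps -> ~ asymptotic_bound (M - eps).
  move=> e0 h; have : M <= M - eps by apply: ge_inf h; exists (- B).
  lra.
exists M => eps e0.
have e20 : 0 < eps / 2%:R by rewrite divr_gt0.
have [N1 hN1] := M_above _ e0; have [N2 hN2] := small_inv K e20.
have [x [Xx hx]] := near_max_interval M_above M_below dense (maxn N0 N2) e20.
move: Xx; rewrite geq_max => /andP[xN0 xN2]; have [x0 Kx] := hN2 _ xN2.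
exists (maxn N1 x) => n; rewrite geq_max => /andP[nN1 nx] j.
have up := hN1 _ nN1 j; have := lower_barrier xN0 x0 hx j nx.
have : 0 <= K / n%:R by rewrite divr_ge0 // ltW.
by rewrite ler_norml => h1 h2; apply/andP; split; lra.
Qed.

End RenewalLimit.

(** * Growth of the solutions of the counting recurrence *)

Section PowerLemmas.
Variable R : realType.
Implicit Types r x : R.

Lemma ler_natpowR r m n : 0 <= r -> (m <= n)%N -> m%:R `^ r <= n%:R `^ r :> R.
Proof. by move=> r0 mn; apply: ge0_ler_powR; rewrite ?nnegrE ?ler_nat. Qed.

Lemma natpowR_ge1 r n : 0 <= r -> (0 < n)%N -> 1 <= n%:R `^ r :> R.
Proof.
by move=> r0 n0; have := @ler_natpowR r 1 n r0 n0; rewrite powR1.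
Qed.

Lemma natpowR_gt0 r n : (0 < n)%N -> 0 < n%:R `^ r :> R.
Proof. by move=> n0; rewrite powR_gt0 // ltr0n. Qed.

Lemma natpowRS r n : 0 < r -> (n%:R : R) `^ (r + 1) = n%:R `^ r * n%:R.
Proof.
by move=> r0; rewrite powRD ?powRr1 // gt_eqF // addr_gt0.
Qed.

Lemma natpowRM r m n : (m * n)%:R `^ r = m%:R `^ r * n%:R `^ r :> R.
Proof. by rewrite natrM powRM. Qed.

Lemma natpowR_div r m n : (0 < n)%N ->
  (m%:R / n%:R) `^ r = m%:R `^ r / n%:R `^ r :> R.
Proof.
move=> n0; have e : (m%:R / n%:R * n%:R) `^ r = m%:R `^ r :> R.
  by rewrite divfK // pnatr_eq0 -lt0n.
by rewrite -e [in RHS]powRM ?divr_ge0 // mulfK // gt_eqF // natpowR_gt0.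
Qed.

(** For 0 < x <= 1 the real power dominates x^N, to which the integer Bernoulli inequality applies.
    Taking N >= r + 1 ensures N >= 1, which settles x = 0. *)
Lemma powR_bernoulli r : 0 <= r -> exists2 C : R, 0 <= C & forall x, 0 <= x <= 1 ->
  1 - C * (1 - x) <= x `^ r <= 1.
Proof.
move=> r0; have [N hN] := nat_above (r + 1); exists N%:R => // x /andP[x0 x1].
apply/andP; split; last by have := ge0_ler_powR r0 x0 ler01 x1; rewrite powR1.
have [->|xn0] := eqVneq x 0.
  have := powR_ge0 0 r; lra.
apply: (@le_trans _ _ (x ^+ N)); last first.
  rewrite -powR_mulrn //; apply: ger_powR; first by rewrite x1 andbT lt_neqAle eq_sym xn0.
  lra.
elim: N {hN} => [|N IH]; first by rewrite expr0 mul0r subr0.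
rewrite exprS -natr1; have := ler_wpM2l x0 IH.
have : 0 <= N%:R * (1 - x) ^+ 2 by rewrite mulr_ge0 ?sqr_ge0.
rewrite expr2; lra.
Qed.

(** Passing from [n] to [n.+1] shifts the classes by one, so all terms but one cancel. *)
Lemma class_sum_diff (g : nat -> R) n m : (0 < m)%N ->
  \sum_(s < m) g (class_size n.+1 m s) - \sum_(s < m) g (class_size n m s)
  = g (n %/ m).+1 - g (n %/ m)%N.
Proof.
case: m => // m _; rewrite big_ord_recl [X in _ - X]big_ord_recr /= class_size0 //.
rewrite -[X in class_size _ _ X]/(m.+1.-1) class_size_last //.
rewrite (eq_bigr (fun s : 'I_m => g (class_size n m.+1 s))); first by rewrite opprD addrA addrK.
by move=> s _; rewrite /bump /= add1n class_sizeSS // ltnS.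
Qed.

End PowerLemmas.

Section Growth.
Variables (R : realType) (I : finType) (p : I -> I -> R) (q : I -> nat) (al K : R) (N0 : nat).
Variable G : I -> nat -> R.
Hypothesis p_gt0 : forall j i, 0 < p j i.
Hypothesis p_sum : forall j, \sum_i p j i = 1.
Hypothesis q_ge2 : forall i, (2 <= q i)%N.
Hypothesis al_gt0 : 0 < al.
Hypothesis K_gt0 : 0 < K.
Hypothesis G_rec : forall j n, (N0 <= n)%N ->
  `|G j n - \sum_i p j i * (q i)%:R `^ al * \sum_(s < q i) G i (class_size n (q i) s)| <= K.

Let qm := (\max_i q i)%N.
Let q_le i : (q i <= qm)%N. Proof. exact: leq_bigmax. Qed.
Let q_gt0 i : (0 < q i)%N. Proof. exact: leq_trans (q_ge2 i). Qed.
Let al_ge0 : 0 <= al. Proof. exact: ltW. Qed.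
Let al1_gt0 : 0 < al + 1. Proof. by rewrite addr_gt0. Qed.
Let al1_ge0 : 0 <= al + 1. Proof. exact: ltW. Qed.

Let beta j n := G j n.+1 - G j n.

(** Differencing the recurrence for [G] collapses each sum over classes to one term, by
    [class_sum_diff]. *)
Lemma beta_rec j n : (N0 <= n)%N ->
  `|beta j n - \sum_i p j i * (q i)%:R `^ al * beta i (n %/ q i)| <= 2%:R * K.
Proof.
move=> hn; have h1 := G_rec j hn; have h2 := G_rec j (leqW hn).
have -> : \sum_i p j i * (q i)%:R `^ al * beta i (n %/ q i) =
  \sum_i p j i * (q i)%:R `^ al * \sum_(s < q i) G i (class_size n.+1 (q i) s) -
  \sum_i p j i * (q i)%:R `^ al * \sum_(s < q i) G i (class_size n (q i) s).
  by rewrite -sumrB; apply: eq_bigr => i _; rewrite -mulrBr class_sum_diff.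
set x := \sum_i _ in h2 *; set y := \sum_i _ in h1 *.
have -> : beta j n - (x - y) = (G j n.+1 - x) - (G j n - y) by rewrite /beta; ring.
by apply: le_trans (ler_normB _ _) _; rewrite mulrDl mul1r lerD.
Qed.

(* Comparison with the supersolution D n^al - E, in which E absorbs the error
   of the recurrence for beta. *)
Lemma beta_bound : exists2 D : R, 0 <= D & forall j n, (0 < n)%N -> `|beta j n| <= D * n%:R `^ al.
Proof.
have t1 : 1 < 2%:R `^ al :> R.
  have := gt0_ltr_powR al_gt0 _ _ (_ : 1 < 2%:R); rewrite powR1 => -> //.
  - by rewrite nnegrE.
  - by rewrite nnegrE.
  - by rewrite ltr1n.
(* [E] solves E 2^al = E + 2K, so the subtracted constant pays for the error even at the smallest
   prime. *)
pose E := 2%:R * K / (2%:R `^ al - 1).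
have E0 : 0 < E by rewrite divr_gt0 ?mulr_gt0 // subr_gt0.
have EE : E * 2%:R `^ al = E + 2%:R * K.
  have : E * (2%:R `^ al - 1) = 2%:R * K by rewrite divfK // gt_eqF // subr_gt0.
  by rewrite mulrBr; lra.
pose N1 := maxn N0 qm.
pose S := \sum_(n < N1) \sum_j `|beta j n|.
have S0 : 0 <= S by apply: sumr_ge0 => n _; apply: sumr_ge0.
have D0 : 0 <= E + S by rewrite addr_ge0 // ltW.
exists (E + S) => // j n n0.
suff : `|beta j n| <= (E + S) * n%:R `^ al - E by lra.
elim/ltn_ind: n n0 j => n IH n0 j.
have [nN|nN] := ltnP n N1.
  have : `|beta j n| <= S.
    rewrite /S (bigD1 (Ordinal nN)) //= (bigD1 j) //= -addrA lerDl addr_ge0 // ?sumr_ge0 // => m _.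
    exact: sumr_ge0.
  have := ler_wpM2l D0 (natpowR_ge1 (ltW al_gt0) n0); lra.
have /andP[nN0 nqm] : (N0 <= n)%N && (qm <= n)%N by rewrite -geq_max.
have := beta_rec j nN0; set s := \sum_i _ => hs.
have {}hs : `|beta j n| <= `|s| + 2%:R * K.
  have := ler_normD (beta j n - s) s; rewrite subrK; lra.
have : `|s| <= \sum_i p j i * ((E + S) * n%:R `^ al - E * 2%:R `^ al).
  apply: le_trans (ler_norm_sum _ _ _) _; apply: ler_sum => i _.
  rewrite -mulrA normrM gtr0_norm // ler_pM2l // normrM ger0_norm ?powR_ge0 //.
  have m0 : (0 < n %/ q i)%N by rewrite divn_gt0 // (leq_trans (q_le i)).
  have mn : (n %/ q i < n)%N by rewrite ltn_Pdiv // q_ge2.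
  apply: le_trans (ler_wpM2l _ (IH _ mn m0 i)) _; first exact: powR_ge0.
  rewrite mulrBr; apply: lerB.
    by rewrite mulrCA ler_wpM2l // -natpowRM ler_natpowR // mulnC leq_trunc_div.
  by rewrite [leRHS]mulrC ler_pM2l // ler_natpowR // q_ge2.
rewrite -mulr_suml p_sum mul1r; lra.
Qed.

Let F j n := G j n / n%:R `^ (al + 1).

Lemma G_bound D : 0 <= D -> (forall j n, (0 < n)%N -> `|beta j n| <= D * n%:R `^ al) ->
  forall j n, (0 < n)%N -> `|G j n| <= (\sum_j `|G j 1%N| + D) * n%:R `^ (al + 1).
Proof.
move=> D0 hD j n n0.
have : `|G j n| <= `|G j 1%N| + D * (n%:R `^ al * n%:R).
  elim: n n0 => // n IH _; case: (posnP n) => [->|n0].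
    by rewrite powR1 mulr1 lerDl mulr_ge0.
  have := ler_normD (G j n) (beta j n); rewrite [G j n + _]addrC subrK => h.
  apply: le_trans h _; have h1 := IH n0; have h2 := hD j n n0.
  have h3 : D * (n%:R `^ al * n%:R) <= D * (n.+1%:R `^ al * n%:R).
    by rewrite ler_wpM2l // ler_wpM2r // ler_natpowR.
  have h4 : D * n%:R `^ al <= D * n.+1%:R `^ al by rewrite ler_wpM2l // ler_natpowR.
  rewrite -[X in _ * (_ * X)]natr1 mulrDr mulr1 mulrDr.
  move: h1 h2 h3 h4; lra.
move=> h; apply: le_trans h _; rewrite mulrDl natpowRS //; apply: lerD => //.
rewrite -natpowRS //; apply: (@le_trans _ _ (\sum_j `|G j 1%N|)).
  by rewrite (bigD1 j) //= lerDl sumr_ge0.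
by rewrite ler_peMr ?sumr_ge0 // natpowR_ge1.
Qed.

Lemma F_bound B : 0 <= B -> (forall j n, (0 < n)%N -> `|G j n| <= B * n%:R `^ (al + 1)) ->
  forall j n, `|F j n| <= B.
Proof.
(* At [n = 0] the denominator vanishes and the quotient is 0. *)
move=> B0 GB j n; case: (posnP n) => [->|n0].
  by rewrite /F powR0 ?invr0 ?mulr0 ?normr0 // gt_eqF.
rewrite normrM normfV [X in _ / X]ger0_norm ?powR_ge0 // ler_pdivrMr ?natpowR_gt0 //.
exact: GB.
Qed.

Lemma FE j n : (0 < n)%N -> F j n * n%:R `^ (al + 1) = G j n.
Proof. by move=> n0; rewrite divfK // gt_eqF // natpowR_gt0. Qed.

Section Regularity.
Variables B C D : R.
Hypothesis C_ge0 : 0 <= C.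
Hypothesis D_ge0 : 0 <= D.
Hypothesis bern : forall x : R, 0 <= x <= 1 -> 1 - C * (1 - x) <= x `^ (al + 1) <= 1.
Hypothesis hD : forall j n, (0 < n)%N -> `|beta j n| <= D * n%:R `^ al.
Hypothesis hB : forall j n, `|F j n| <= B.

(** The increment splits into that of [G], of order n^al, and that of the denominator, controlled by
    [bern]. *)
Lemma F_increment j n : (0 < n)%N -> `|F j n.+1 - F j n| <= (D + B * C) / n%:R.
Proof.
move=> n0; have n0R : 0 < n%:R :> R by rewrite ltr0n.
have P0 : 0 < n%:R `^ (al + 1) :> R by apply: natpowR_gt0.
have P1 : 0 < n.+1%:R `^ (al + 1) :> R by apply: natpowR_gt0.
pose x : R := n%:R / n.+1%:R.
have x01 : 0 <= x <= 1.
  by rewrite divr_ge0 //= ler_pdivrMr ?ltr0n // mul1r ler_nat.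
have := bern x01; rewrite {2}/x natpowR_div // => /andP[h1 h2].
have -> : F j n.+1 - F j n = beta j n / n.+1%:R `^ (al + 1)
    - F j n * (1 - n%:R `^ (al + 1) / n.+1%:R `^ (al + 1)).
  rewrite /F /beta; field; by rewrite !gt_eqF.
apply: le_trans (ler_normB _ _) _; rewrite [leRHS]mulrDl; apply: lerD.
  rewrite normrM normfV (gtr0_norm P1).
  apply: (@le_trans _ _ (D * n%:R `^ al / n%:R `^ (al + 1))).
    by apply: ler_pM => //; rewrite ?invr_ge0 ?powR_ge0 ?hD // lef_pV2 ?posrE // ler_natpowR.
  rewrite natpowRS // invfM mulrA -[D * _ / _]mulrA divff ?mulr1 //.
  by rewrite gt_eqF // natpowR_gt0.
rewrite normrM -mulrA; apply: ler_pM => //.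
rewrite ger0_norm ?subr_ge0 // lerBlDr -lerBlDl; apply: le_trans h1.
rewrite lerD2l lerN2 ler_wpM2l //.
have -> : 1 - x = n.+1%:R^-1.
  rewrite /x -natr1; field; by rewrite natr1 pnatr_eq0.
by rewrite lef_pV2 ?posrE ?ltr0n // ler_nat.
Qed.

(** Replacing each class size by n %/ q_i costs an increment of [G]; replacing q_i (n %/ q_i) by [n]
    inside the power costs a term bounded by [bern]. Both are O(n^al), hence O(1/n) after
    normalization. *)
Lemma F_recurrence j n : (N0 <= n)%N -> (qm <= n)%N -> (0 < n)%N ->
  `|F j n - \sum_i p j i * F i (n %/ q i)| <= (K + qm%:R * D + B * C * qm%:R) / n%:R.
Proof.
move=> nN0 nqm n0; have n0R : 0 < n%:R :> R by rewrite ltr0n.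
have P0 : 0 < n%:R `^ (al + 1) :> R by apply: natpowR_gt0.
pose E := (qm%:R * D + B * C * qm%:R) * n%:R `^ al.
have term i : `|(q i)%:R `^ al * (\sum_(s < q i) G i (class_size n (q i) s))
     - n%:R `^ (al + 1) * F i (n %/ q i)| <= E.
  set m := (n %/ q i)%N; set Sg := \sum_(s < _) _.
  have m0 : (0 < m)%N by rewrite divn_gt0 // (leq_trans (q_le i)).
  have qmn : (q i * m <= n)%N by rewrite mulnC leq_trunc_div.
  have h1 : `|Sg - (q i)%:R * G i m| <= (q i)%:R * (D * m%:R `^ al).
    rewrite !mulr_natl -[X in _ *+ X]card_ord -!sumr_const -sumrB.
    apply: le_trans (ler_norm_sum _ _ _) _; rewrite -[X in _ *+ X]card_ord -sumr_const.
    apply: ler_sum => s _.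
    have := class_size_bounds n (ltn_ord s); rewrite -/m => /andP[].
    rewrite leq_eqVlt => /orP[/eqP<- _|h1 h2].
      by rewrite subrr normr0 mulr_ge0 // powR_ge0.
    have -> : class_size n (q i) s = m.+1 by apply/eqP; rewrite eqn_leq h2.
    exact: hD.
  have h2 : (q i)%:R `^ al * ((q i)%:R * G i m) = (q i * m)%:R `^ (al + 1) * F i m.
    by rewrite natpowRM mulrA -natpowRS // -(FE i m0); ring.
  pose x : R := (q i * m)%:R / n%:R.
  have x01 : 0 <= x <= 1.
    by rewrite divr_ge0 //= ler_pdivrMr // mul1r ler_nat.
  have := bern x01; rewrite {2}/x natpowR_div // => /andP[hb1 hb2].
  have h3 : `|(q i * m)%:R `^ (al + 1) * F i m - n%:R `^ (al + 1) * F i m|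
     <= B * C * qm%:R * n%:R `^ al.
    rewrite -mulrBl normrM mulrC -!mulrA; apply: ler_pM => //.
    rewrite distrC ger0_norm; last by rewrite subr_ge0 ler_natpowR.
    have -> : n%:R `^ (al + 1) - (q i * m)%:R `^ (al + 1) =
        n%:R `^ (al + 1) * (1 - (q i * m)%:R `^ (al + 1) / n%:R `^ (al + 1)) :> R.
      by field; rewrite gt_eqF.
    apply: (@le_trans _ _ (n%:R `^ (al + 1) * (C * (1 - x)))).
      by rewrite ler_pM2l // lerBlDr -lerBlDl.
    rewrite mulrCA ler_wpM2l // natpowRS // -mulrA [qm%:R * _]mulrC ler_wpM2l ?powR_ge0 //.
    rewrite mulrBr mulr1 /x mulrCA divff ?gt_eqF // mulr1 lerBlDr -natrD ler_nat.
    have := ltn_ceil n (q_gt0 i); rewrite -/m mulSn mulnC => /ltnW h; apply: leq_trans h _.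
    by rewrite leq_add2r.
  have -> : (q i)%:R `^ al * Sg - n%:R `^ (al + 1) * F i m =
     (q i)%:R `^ al * (Sg - (q i)%:R * G i m) +
     ((q i * m)%:R `^ (al + 1) * F i m - n%:R `^ (al + 1) * F i m).
    by rewrite -h2; ring.
  apply: le_trans (ler_normD _ _) _; rewrite /E mulrDl; apply: lerD => //.
  rewrite normrM ger0_norm ?powR_ge0 //.
  apply: le_trans (ler_wpM2l (powR_ge0 _ _) h1) _.
  have -> : (q i)%:R `^ al * ((q i)%:R * (D * m%:R `^ al)) = (q i)%:R * D * (q i * m)%:R `^ al.
    by rewrite natpowRM; ring.
  apply: ler_pM; rewrite ?mulr_ge0 ?powR_ge0 // ?ler_natpowR //.
  by rewrite ler_wpM2r // ler_nat.
have sumE : `|\sum_i p j i * (q i)%:R `^ al * (\sum_(s < q i) G i (class_size n (q i) s))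
   - n%:R `^ (al + 1) * \sum_i p j i * F i (n %/ q i)| <= E.
  rewrite mulr_sumr -sumrB; apply: le_trans (ler_norm_sum _ _ _) _.
  rewrite (_ : E = \sum_i p j i * E); last by rewrite -mulr_suml p_sum mul1r.
  apply: ler_sum => i _.
  rewrite mulrCA -mulrA -mulrBr normrM gtr0_norm // ler_pM2l //; exact: term.
rewrite ler_pdivlMr // -(ler_pM2r (natpowR_gt0 al n0)) -[leLHS]mulrA [n%:R * _]mulrC -natpowRS //.
rewrite -(gtr0_norm P0) -normrM mulrBl (FE j n0) [X in _ - X]mulrC.
have := G_rec j nN0; set X := \sum_i _ in sumE *; set Y := \sum_i _ in sumE * => hX.
have -> : G j n - n%:R `^ (al + 1) * Y = (G j n - X) + (X - n%:R `^ (al + 1) * Y) by ring.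
apply: le_trans (ler_normD _ _) _; rewrite -addrA [leRHS]mulrDl; apply: lerD => //.
apply: le_trans hX _; rewrite ler_peMr ?natpowR_ge1 //; exact: ltW.
Qed.

End Regularity.

Lemma growth_limit (i1 i2 : I) :
  (forall eta, 0 < eta -> exists y0 : R, forall y, y0 <= y ->
    exists a b : nat, y <= (q i1 ^ a * q i2 ^ b)%:R <= (1 + eta) * y) ->
  exists M : R, forall eps, 0 < eps -> exists N : nat, forall n, (N <= n)%N ->
    forall j, `|F j n - M| <= eps.
Proof.
move=> dense; have [D D0 hD] := beta_bound; have [C C0 hC] := powR_bernoulli al1_ge0.
pose B := \sum_j `|G j 1%N| + D.
have B0 : 0 <= B by rewrite addr_ge0 // sumr_ge0.
have FB := F_bound B0 (G_bound D0 hD).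
have h1 : 0 <= B * C by rewrite mulr_ge0.
have h2 : 0 <= K + qm%:R * D + B * C * qm%:R by rewrite !addr_ge0 ?mulr_ge0 // ltW.
pose K' := D + B * C + (K + qm%:R * D + B * C * qm%:R) + 1.
have K'0 : 0 < K' by rewrite /K' ltr_wpDl // addr_ge0 // addr_ge0.
pose N1 := maxn (maxn N0 qm) 1.
apply: (@renewal_limit R I p q K' N1 F p_gt0 p_sum q_ge2 K'0 _ _ i1 i2 B dense FB).
- move=> j n; rewrite !geq_max => /andP[/andP[nN0 nqm] n0].
  apply: le_trans (F_recurrence C0 D0 hC hD FB j nN0 nqm n0) _.
  by rewrite ler_pM2r ?invr_gt0 ?ltr0n // /K'; lra.
- move=> j n n0; apply: le_trans (F_increment C0 hC hD FB j n0) _.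
  by rewrite ler_pM2r ?invr_gt0 ?ltr0n // /K'; lra.
Qed.

(* c (n+1)^(al+1) + K is a subsolution because (n %/ q) + 1 >= (n + 1) / q. *)
Lemma growth_lower : (forall C, exists N : nat, forall n, (N <= n)%N -> forall j, C <= G j n) ->
  exists2 c : R, 0 < c & exists N : nat, forall n, (N <= n)%N -> forall j, c <= F j n.
Proof.
move=> G_inf; have [N hN] := G_inf (K + 1).
pose N1 := maxn (maxn N N0) 2; pose X := (qm * N1).+1.
have X0 : 0 < X%:R `^ (al + 1) :> R by apply: natpowR_gt0.
(* This keeps c (n+1)^(al+1) at most 1 on the starting range [n < qm * N1], where [G] is at least K
   + 1. *)
pose c : R := (X%:R `^ (al + 1))^-1; have c0 : 0 < c by rewrite invr_gt0.
exists c => //; exists N1.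
suff H n j : (N1 <= n)%N -> c * n.+1%:R `^ (al + 1) + K <= G j n.
  move=> n hn j; have n0 : (0 < n)%N by apply: leq_trans hn; rewrite leq_max orbT.
  rewrite ler_pdivlMr ?natpowR_gt0 //; apply: le_trans (H n j hn).
  rewrite -[leLHS]addr0; apply: lerD; last exact: ltW.
  by rewrite ler_pM2l // ler_natpowR.
elim/ltn_ind: n j => n IH j hn; move: (hn).
rewrite !geq_max => /andP[/andP[nN nN0] n2].
have [nX|nX] := ltnP n (qm * N1).
  apply: le_trans (hN n nN j); rewrite addrC lerD2l.
  by rewrite mulrC ler_pdivrMr // mul1r ler_natpowR //; apply: leqW.
have := G_rec j nN0; rewrite ler_norml => /andP[h _].
(* The sums at least double the constant [K], and the error of the recurrence takes one copy
   back. *)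
have : \sum_i p j i * (c * n.+1%:R `^ (al + 1) + 2%:R * K) <=
   \sum_i p j i * (q i)%:R `^ al * \sum_(s < q i) G i (class_size n (q i) s).
  apply: ler_sum => i _; rewrite -[leRHS]mulrA ler_pM2l //.
  set m := (n %/ q i)%N.
  have mN1 : (N1 <= m)%N.
    by rewrite leq_divRL //; apply: leq_trans nX; rewrite mulnC leq_mul2r q_le orbT.
  have : (q i)%:R * (c * m.+1%:R `^ (al + 1) + K) <= \sum_(s < q i) G i (class_size n (q i) s).
    rewrite mulr_natl -[X in _ *+ X]card_ord -sumr_const; apply: ler_sum => s _.
    have /andP[h1 h2] := class_size_bounds n (ltn_ord s).
    have csN : (N1 <= class_size n (q i) s)%N by apply: leq_trans h1.
    apply: le_trans (IH _ _ i csN); last exact: class_size_lt.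
    by rewrite lerD2r ler_pM2l // ler_natpowR.
  move=> h3; apply: le_trans (ler_wpM2l (powR_ge0 _ _) h3).
  rewrite mulrA -natpowRS // mulrDr; apply: lerD.
    by rewrite mulrCA ler_pM2l // -natpowRM ler_natpowR // mulnC ltn_ceil.
  rewrite ler_pM2r //; apply: (@le_trans _ _ (q i)%:R); first by rewrite ler_nat q_ge2.
  by rewrite natpowRS // ler_peMl // natpowR_ge1.
rewrite -mulr_suml p_sum mul1r; lra.
Qed.

End Growth.

(** * The exponent *)

Section Exponent.
Variable R : realType.
Implicit Types (x y : R) (s : seq nat).

Definition euler_product s x : R := \prod_(q <- s) (1 - q%:R `^ (- x)).

Lemma euler_factor_ge0 (q : nat) x : (0 < q)%N -> 0 <= x -> 0 <= 1 - q%:R `^ (- x).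
Proof.
move=> q0 x0; rewrite subr_ge0 powRN invf_le1 ?natpowR_gt0 //; exact: natpowR_ge1.
Qed.

Lemma euler_factor_lt (q : nat) x y : (1 < q)%N -> x < y ->
  1 - q%:R `^ (- x) < 1 - q%:R `^ (- y) :> R.
Proof.
move=> q1 xy; have q0 : (0 < q)%N by apply: ltnW.
rewrite ltrD2l ltrN2 /powR pnatr_eq0 (gtn_eqF q0) ltr_expR !mulNr ltrN2.
by rewrite ltr_pM2r // ln_gt0 // ltr1n.
Qed.

Lemma euler_factor_gt0 (q : nat) x : (1 < q)%N -> 0 < x -> 0 < 1 - q%:R `^ (- x).
Proof.
move=> q1 x0; have := euler_factor_lt q1 x0; rewrite oppr0 powRr0 subrr //.
Qed.

Lemma euler_product_lt s x y : s != [::] -> (forall q, q \in s -> (1 < q)%N) ->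
  0 < x -> x < y -> euler_product s x < euler_product s y.
Proof.
case: s => // q s _ hs x0 xy; have y0 : 0 < y by apply: lt_trans xy.
rewrite /euler_product !big_cons.
have q1 : (1 < q)%N by apply: hs; rewrite mem_head.
have hs' r : r \in s -> (1 < r)%N by move=> rs; apply: hs; rewrite inE rs orbT.
have c0 : 0 < \prod_(r <- s) (1 - r%:R `^ (- x)).
  by rewrite big_seq prodr_gt0 // => r /hs' r1; exact: euler_factor_gt0.
apply: (@lt_le_trans _ _ ((1 - q%:R `^ (- y)) * \prod_(r <- s) (1 - r%:R `^ (- x)))).
  by rewrite ltr_pM2r // euler_factor_lt.
rewrite ler_pM2l ?euler_factor_gt0 // big_seq [leRHS]big_seq; apply: ler_prod => r /hs' r1.
by rewrite ltW ?euler_factor_gt0 //= ltW // euler_factor_lt.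
Qed.

Lemma euler_product_continuous s : (forall q, q \in s -> (0 < q)%N) ->
  continuous (euler_product s).
Proof.
elim: s => [|q s IH] hs.
  have -> : euler_product [::] = cst 1 by apply/funext => x; rewrite /euler_product big_nil.
  exact: cst_continuous.
have q0 : (0 < q)%N by apply: hs; rewrite mem_head.
have -> : euler_product (q :: s) =
    (fun x => (1 - expR (- x * ln (q%:R : R))) * euler_product s x).
  apply/funext => x; rewrite /euler_product big_cons; congr (_ * _).
  by rewrite /powR pnatr_eq0 (gtn_eqF q0).
move=> x; apply: cvgM; last first.
  by apply: IH => r rs; apply: hs; rewrite inE rs orbT.
apply: cvgB; first exact: cvg_cst.
apply: continuous_comp; last exact: continuous_expR.
apply: cvgMl; exact: opp_continuous.
Qed.

(** Since q^n >= n + 1, each factor loses at most 1/(n+1). This quantifies the limit 1 at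
    infinity. *)
Lemma euler_product_large s (n : nat) : (forall q, q \in s -> (1 < q)%N) ->
  1 - (size s)%:R / n.+1%:R <= euler_product s n%:R.
Proof.
elim: s => [|q s IH] hs; first by rewrite /euler_product big_nil mul0r subr0.
have q1 : (1 < q)%N by apply: hs; rewrite mem_head.
have hs' r : r \in s -> (1 < r)%N by move=> rs; apply: hs; rewrite inE rs orbT.
rewrite /euler_product big_cons -/(euler_product s n%:R) /= -natr1 mulrDl mul1r.
have h : (q%:R : R) `^ (- n%:R) <= n.+1%:R^-1.
  rewrite powRN powR_mulrn // lef_pV2 ?posrE ?exprn_gt0 ?ltr0n ?(ltnW q1) //.
  by rewrite -natrX ler_nat ltn_expl.
have p1 : euler_product s n%:R <= 1.
  rewrite /euler_product big_seq; apply: prodr_ile1 => r /hs' r1.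
  by rewrite euler_factor_ge0 ?(ltnW r1) //= gerBl powR_ge0.
have p0 : 0 <= euler_product s n%:R.
  by rewrite /euler_product big_seq prodr_ge0 // => r /hs' r1; rewrite euler_factor_ge0 // ltnW.
move: (IH hs') p0 p1 h (powR_ge0 (q%:R : R) (- n%:R)).
move: (euler_product s n%:R) (_ `^ _) (n.+1%:R^-1) => P t u h p0 p1 tu t0.
by have := ler_piMr t0 p1; move: h tu; lra.
Qed.

(** Intermediate values between 0, where the product vanishes, and a large integer; uniqueness by
    strict monotonicity. *)
Lemma euler_product_root s (v : R) : s != [::] -> (forall q, q \in s -> (1 < q)%N) ->
  0 < v < 1 -> exists x, [/\ 0 < x, v = euler_product s x &
    forall y, 0 < y -> v = euler_product s y -> x = y].
Proof.
move=> s0 hs /andP[v0 v1].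
have [n hn] := nat_above ((size s)%:R / (1 - v)).
have hv : v <= euler_product s n%:R.
  apply: le_trans (euler_product_large n hs).
  rewrite lerBrDr -lerBrDl ler_pdivrMr ?ltr0n // mulrC -ler_pdivrMr ?subr_gt0 //.
  by apply: le_trans hn _; rewrite ler_nat.
have z0 : euler_product s 0 = 0.
  case: s s0 {hs hn hv} => // q s _.
  by rewrite /euler_product big_cons oppr0 powRr0 subrr mul0r.
have [||x] := @IVT R (euler_product s) 0 n%:R v (ler0n _ _).
- apply: continuous_subspaceT => x; apply: euler_product_continuous => q /hs; exact: ltnW.
- by rewrite z0 ge_min (ltW v0) le_max hv orbT.
rewrite in_itv /= => /andP[x0 _] xv.
have {}x0 : 0 < x.
  by rewrite lt_neqAle x0 andbT; apply/eqP => x0'; move: v0; rewrite -xv -x0' z0 ltxx.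
exists x; split=> // y y0 yv; case: (ltgtP x y) => // h.
  have := euler_product_lt s0 hs x0 h; rewrite xv -yv ltxx //.
have := euler_product_lt s0 hs y0 h; rewrite xv -yv ltxx //.
Qed.

End Exponent.

(** * Arithmetical factors of the universal Toeplitz word *)

Lemma arith_complexity_toeplitz (k : nat) (A : finType) (q : 'I_k -> nat) (a0 : A) (i0 : 'I_k) n :
  (forall i, prime (q i)) -> (0 < n)%N ->
  arith_complexity (toeplitz q a0 (universal_stream (i0, a0))) n = #|layered_words q a0 n|.
Proof.
move=> q_prime n0; apply: eq_card => u; rewrite !inE; apply: asbool_equiv_eq; split.
  move=> [c [r [m [r0 uE]]]].
  have mn : m.+1 = n by rewrite -(size_tuple u) uE size_mkseq.
  apply: (@eq_layered _ _ q n (fun x => toeplitz q a0 (universal_stream (i0, a0)) (c + x * r))).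
    by move=> x xn; rewrite uE nth_mkseq // mn.
  exact: toeplitz_layered.
move=> hu; have [tau H] := layered_toeplitz q_prime a0 (i0, a0) hu.
have [j hj] := universal_streamP (i0, a0) tau.
have [c c0 hc] := H (fun m => universal_stream (i0, a0) (j + m)) hj.
set sigma := universal_stream (i0, a0).
pose P := (\prod_(i < j) q (sigma i).1)%N.
(* Sampling with difference [P] skips [j] entries of the stream; what remains starts with [tau] and
   shows [u] from position [c]. *)
exists (P * c)%N, P, n.-1; rewrite prednK //; split.
  by rewrite prodn_gt0 // => i; apply: prime_gt0.
apply: (@eq_from_nth _ a0); rewrite ?size_tuple ?size_mkseq // => x xn.
rewrite nth_mkseq // [(x * P)%N]mulnC -mulnDr toeplitz_scale //; exact: hc.
Qed.

(** * Asymptotics of the number of layered words *)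

Section Assembly.
Variables (R : realType) (k d : nat) (q : 'I_k -> nat) (al : R).
Hypothesis q_prime : forall i, prime (q i).
Hypothesis q_inj : injective q.
Hypothesis d_gt1 : (1 < d)%N.
Hypothesis al_gt0 : 0 < al.
Hypothesis al_root : (d%:R - 1) / d%:R = \prod_(i < k) (1 - (q i)%:R `^ (- al)).
Variables (a0 : 'I_d) (i1 i2 : 'I_k).
Hypothesis i12 : i1 != i2.

Definition partial_product (m : nat) : R := \prod_(i < k | (i < m)%N) (1 - (q i)%:R `^ (- al)).

Lemma partial_product_gt0 m : 0 < partial_product m.
Proof. by apply: prodr_gt0 => i _; apply: euler_factor_gt0 => //; apply: prime_gt1. Qed.

Lemma partial_productS (i : 'I_k) :
  partial_product i.+1 = (1 - (q i)%:R `^ (- al)) * partial_product i.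
Proof.
rewrite /partial_product (bigD1 i) //=; congr (_ * _); apply: eq_bigl => l.
by rewrite ltnS andbC leq_eqVlt -(inj_eq val_inj) /=; case: ltngtP.
Qed.

(** Each term equals h_i - h_(i+1), so the sum telescopes. *)
Lemma partial_product_sum m : (m <= k)%N ->
  \sum_(i < k | (i < m)%N) (q i)%:R `^ (- al) * partial_product i = 1 - partial_product m.
Proof.
elim: m => [|m IH] mk.
  by rewrite big_pred0 // /partial_product big_pred0 // subrr.
pose i := Ordinal mk; rewrite (partial_productS i) (bigD1 i) //=.
rewrite (eq_bigl (fun l : 'I_k => (l < m)%N)); last first.
  by move=> l; rewrite ltnS andbC leq_eqVlt -(inj_eq val_inj) /=; case: ltngtP.
by rewrite IH ?(ltnW mk) //=; ring.
Qed.

(** The equation for alpha enters here: h_k = (d - 1)/d, that is, d (1 - h_k) = 1. It makes the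
    normalized weights of the recurrence sum to 1. *)
Lemma partial_product_eq (j : 'I_k) :
  \sum_(i < k) (d%:R - (i < j)%N%:R) * ((q i)%:R `^ (- al) * partial_product i)
  = partial_product j.
Proof.
have d0 : d%:R != 0 :> R by rewrite pnatr_eq0 -lt0n ltnW.
have e1 := partial_product_sum (leqnn k); have e2 := partial_product_sum (ltnW (ltn_ord j)).
have hk : partial_product k = (d%:R - 1) / d%:R.
  by rewrite al_root /partial_product; apply: eq_bigl => i; rewrite ltn_ord.
transitivity (d%:R * (1 - partial_product k) - (1 - partial_product j)); last first.
  by rewrite hk; field.
rewrite -e1 -e2 mulr_sumr [X in X - _]big_mkcond [X in _ - X]big_mkcond -sumrB.
apply: eq_bigr => i _; rewrite ltn_ord mulrBl; congr (_ - _).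
by case: (i < j)%N; rewrite ?mul1r ?mul0r.
Qed.

(** [growth_limit] for G_j = A_j / h_j yields a limit M, positive by [growth_lower]. Since h_0 = 1
    and A_0 = d (a - 1), with a the number of layered words, the constant is M/d. *)
Lemma layered_words_growth : exists C : R, 0 < C /\
  forall eps, 0 < eps -> exists N : nat, forall n, (N <= n)%N ->
   `|C - #|layered_words q a0 n|%:R / n%:R `^ (al + 1)| <= eps.
Proof.
set h := partial_product; have h0 := partial_product_gt0.
pose w (j i : 'I_k) : R := d%:R - (i < j)%N%:R.
have w0 j i : 0 < w j i.
  by rewrite subr_gt0; apply: le_lt_trans (_ : 1 < _); [case: (i < j)%N|rewrite ltr1n].
pose p j i := w j i * ((q i)%:R `^ (- al) * h i) / h j.
have q1 i : (1 < q i)%N := prime_gt1 (q_prime i).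
have q0 i : (0 < q i)%N := prime_gt0 (q_prime i).
have p0 j i : 0 < p j i by rewrite divr_gt0 ?mulr_gt0 ?natpowR_gt0.
have p1 j : \sum_i p j i = 1.
  by rewrite -mulr_suml partial_product_eq divff // gt_eqF.
pose Ac (j : 'I_k) n : R := (fresh_count q a0 j n)%:R.
pose G j n := Ac j n / h j.
pose K0 : R := (d ^ 2 + d ^ 4)%:R.
pose K := K0 * (\sum_(j < k) (h j)^-1) + 1.
have K00 : 0 <= K0 by [].
have sh0 : 0 <= \sum_(j < k) (h j)^-1 by apply: sumr_ge0 => j _; rewrite invr_ge0 ltW.
have Kpos : 0 < K by rewrite ltr_wpDl // mulr_ge0.
pose N0 := background_bound q.
have G_rec j n : (N0 <= n)%N ->
  `|G j n - \sum_i p j i * (q i)%:R `^ al * \sum_(s < q i) G i (class_size n (q i) s)| <= K.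
  move=> nN; have := @fresh_count_rec k _ q q_prime q_inj a0 R j n nN.
  rewrite card_ord -/K0 => hr.
  have -> : \sum_i p j i * (q i)%:R `^ al * (\sum_(s < q i) G i (class_size n (q i) s)) =
    (\sum_i w j i * \sum_(s < q i) Ac i (class_size n (q i) s)) / h j.
    rewrite mulr_suml; apply: eq_bigr => i _; rewrite -mulr_suml /p powRN.
    have : (q i)%:R `^ al != 0 :> R by rewrite gt_eqF ?natpowR_gt0.
    have : h i != 0 by rewrite gt_eqF.
    have : h j != 0 by rewrite gt_eqF.
    by move=> *; field; apply/and3P.
  rewrite -mulrBl normrM normfV (gtr0_norm (h0 j)).
  apply: (@le_trans _ _ (K0 * (h j)^-1)); first by rewrite ler_pM2r ?invr_gt0.
  apply: (@le_trans _ _ (K0 * \sum_(j < k) (h j)^-1)); last by rewrite lerDl.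
  rewrite ler_wpM2l // (bigD1 j) //= lerDl sumr_ge0 // => l _.
  by rewrite invr_ge0 ltW.
have G_inf C : exists N : nat, forall n, (N <= n)%N -> forall j, C <= G j n.
  have [N hN] := nat_above (`|C| + (d ^ 3)%:R).
  exists (maxn N0 N) => n; rewrite geq_max => /andP[nN0 nN] j.
  have := fresh_count_ge q_prime q_inj a0 i1 (n := n) (j := j).
  rewrite card_ord => /(_ d_gt1 (ltnW (ltn_ord j)) nN0).
  rewrite -(ler_nat R) natrD => hn.
  have hC : `|C| <= Ac j n.
    have : (N%:R : R) <= n%:R by rewrite ler_nat.
    by rewrite /Ac; lra.
  have hj1 : h j <= 1.
    rewrite -(subr_ge0 (h j)) -(partial_product_sum (ltnW (ltn_ord j))).
    by apply: sumr_ge0 => i _; rewrite mulr_ge0 ?powR_ge0 // ltW.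
  rewrite ler_pdivlMr //; apply: le_trans hC.
  apply: le_trans (ler_norm _) _; rewrite normrM (gtr0_norm (h0 j)).
  by rewrite ler_piMr.
have q2 i : (2 <= q i)%N by apply: q1.
have dense eta : 0 < eta -> exists y0 : R, forall y, y0 <= y ->
    exists a b : nat, y <= (q i1 ^ a * q i2 ^ b)%:R <= (1 + eta) * y.
  by apply: prime_power_products_dense => //; apply: contra i12 => /eqP/q_inj->.
have [M hM] := growth_limit p0 p1 q2 al_gt0 Kpos G_rec dense.
have [c c0 [N hc]] := growth_lower p0 p1 q2 al_gt0 Kpos G_rec G_inf.
have cM : c <= M.
  apply/ler_addgt0Pr => e e0; have [N1 h1] := hM e e0.
  have := hc (maxn N N1) (leq_maxl _ _) i1.
  have := h1 (maxn N N1) (leq_maxr _ _) i1; rewrite ler_norml => /andP[]; lra.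
have d0 : 0 < d%:R :> R by rewrite ltr0n ltnW.
exists (M / d%:R); split; first by rewrite divr_gt0 // (lt_le_trans c0).
move=> e e0.
have k0 : (0 < k)%N by apply: leq_ltn_trans (ltn_ord i1).
pose j0 := Ordinal k0.
have e20 : 0 < e / 2%:R by rewrite divr_gt0.
have [N1 h1] := hM _ e20; have [N2 h2] := small_inv 1 e20.
exists (maxn N1 N2) => n; rewrite geq_max => /andP[n1 n2].
have [n0 hn] := h2 n n2; have {h1} := h1 n n1 j0.
have P0 : 0 < n%:R `^ (al + 1) :> R by apply: natpowR_gt0.
have hj0 : h j0 = 1 by rewrite /h /partial_product big_pred0.
have ea : #|layered_words q a0 n|%:R = Ac j0 n / d%:R + 1.
  have := @fresh_countE k _ q q_prime q_inj a0 i1 0 n (leq0n _).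
  rewrite big_pred0 // addn0 card_ord => /(congr1 (fun m : nat => m%:R : R)).
  rewrite natrD natrM -/(Ac j0 n) => ee.
  apply: (mulfI (lt0r_neq0 d0)); rewrite -ee mulrDr mulr1 mulrCA divff ?mulr1 //.
  exact: lt0r_neq0.
rewrite /G hj0 divr1 => h3.
have -> : M / d%:R - #|layered_words q a0 n|%:R / n%:R `^ (al + 1) =
  - ((Ac j0 n / n%:R `^ (al + 1) - M) / d%:R) - (n%:R `^ (al + 1))^-1.
  by rewrite ea; field; rewrite !gt_eqF.
apply: le_trans (ler_normB _ _) _; rewrite normrN [leRHS]splitr; apply: lerD.
  apply: le_trans h3; rewrite normrM normfV (gtr0_norm d0) ler_piMr // invf_le1 // ler1n.
  exact: ltnW.
rewrite normfV gtr0_norm //; apply: le_trans hn; rewrite div1r lef_pV2 ?posrE ?ltr0n //.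
by rewrite natpowRS // ler_peMl // natpowR_ge1 // ltW.
Qed.

End Assembly.

Theorem theorem1 (R : realType) (Q : {fset nat})
    (hQ : forall q : nat, q \in Q -> prime q)
    (hk : (2 <= #|` Q|)%N)
    (d : nat) (hd : (1 < d)%N) :
  exists alpha : R,
    unique (positive_root Q d) alpha /\
    exists w : infinite_word 'I_d,
    exists C : R,
      0 < C /\
      (fun n : nat => (arith_complexity w n)%:R / n%:R `^ (alpha + 1))
        @ \oo --> C.
Proof.
pose s : seq nat := enum_fset Q.
have s_size : size s = #|` Q| by rewrite cardfE.
have s_prime r : r \in s -> prime r by move=> rs; apply: hQ.
have s_gt1 r : r \in s -> (1 < r)%N by move=> /s_prime/prime_gt1.
have s0 : s != [::] by rewrite -size_eq0 s_size -lt0n ltnW.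
have d0 : 0 < d%:R :> R by rewrite ltr0n ltnW.
have d1 : 1 < d%:R :> R by rewrite ltr1n.
have v01 : 0 < ((d%:R - 1) / d%:R : R) < 1.
  by rewrite divr_gt0 ?subr_gt0 //= ltr_pdivrMr // mul1r ltrBlDr ltrDl.
have [al [al0 al_root al_uniq]] := euler_product_root s0 s_gt1 v01.
exists al; split; first by split=> // y [y0 yr]; apply: al_uniq.
pose k := size s; pose q (i : 'I_k) := nth 0%N s i.
have q_prime i : prime (q i) by apply/s_prime/mem_nth.
have q_inj : injective q.
  move=> i j /eqP; rewrite nth_uniq ?fset_uniq // => /eqP; exact: val_inj.
have k2 : (1 < k)%N by rewrite /k s_size.
pose i1 : 'I_k := Ordinal (ltnW k2); pose i2 : 'I_k := Ordinal k2.
pose a0 : 'I_d := Ordinal (ltnW hd).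
have root' : (d%:R - 1) / d%:R = \prod_(i < k) (1 - (q i)%:R `^ (- al)) :> R.
  by rewrite al_root /euler_product (big_nth 0%N) big_mkord.
have i12 : i1 != i2 by [].
have [C [C0 hC]] := layered_words_growth q_prime q_inj hd al0 root' a0 i12.
exists (toeplitz q a0 (universal_stream (i1, a0))), C; split=> //.
apply/cvgrPdist_le => e e0; have [N hN] := hC e e0.
exists N.+1 => // n /= nN; rewrite arith_complexity_toeplitz //.
  by apply: hN; apply: ltnW.
exact: leq_ltn_trans nN.
Qed.
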